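(* Let $q$ be a prime power, let $J=\{0,1,\dots,q\}$, let $\Delta_1,\Delta_2,\Delta_3\subset \mathbb Z/(q^2+q+1)$ be any three classical difference sets (for the classical projective plane of order $q$) containing $0$, and let $\delta_\alpha:J\to\Delta_\alpha$, $\alpha\in\{1,2,3\}$, be any bijections satisfying $\delta_\alpha(0)=0$. Then the group $$\Gamma_2=\bigl\langle \sigma_1,\sigma_2,\sigma_3 \ \big|\ \sigma_1^{q^2+q+1}=\sigma_2^{q^2+q+1}=\sigma_3^{q^2+q+1}=1,\ \ \sigma_1^{\delta_1(j)}\sigma_2^{\delta_2(j)}\sigma_3^{\delta_3(j)}=1\ \ \forall j\in J\bigr\rangle$$ is a uniform lattice in (the automorphism group of) a building of type $\tilde A_2$.
   Context: The classical projective plane of order $q$ is the projective plane over $\mathbb F_q$. It admits cyclic groups $S=\langle\sigma\rangle$ of order $q^2+q+1$ of automorphisms acting regularly (transitively and freely) on points (and hence on lines), called cyclic Singer groups. Given such $S$ with generator $\sigma$, a point $p$ and a line $l$, the associated classical difference set is $$\Delta=\{\delta\in\mathbb Z/(q^2+q+1) : p \text{ is incident to } \sigma^{\delta}(l)\}.$$ It has $q+1$ elements, and contains $0$ if and only if $p$ and $l$ are incident. Buildings of type $\tilde A_2$ are the thick two-dimensional affine buildings of that Coxeter type. A uniform lattice in a locally finite building $X$ is a discrete cocompact subgroup of the locally compact group $\operatorname{Aut}(X)$. *)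

(* Defs.v *)
From HB Require Import structures.
From mathcomp Require Import all_boot all_order all_algebra perm.
From mathcomp Require Import all_classical all_reals all_analysis.

Set Implicit Arguments.
Unset Strict Implicit.
Unset Printing Implicit Defensive.

Local Open Scope classical_set_scope.
Local Open Scope group_scope.
Local Open Scope quotient_scope.

(* A letter [(x, false)] is the generator [x]; [(x, true)] is its inverse. *)
Definition word (I : Type) : Type := seq (I * bool).

Definition word_inv (I : Type) (w : word I) : word I :=
  rev [seq (l.1, ~~ l.2) | l <- w].

(* The congruence on words whose quotient is < I | r = 1 for r in R >. *)
Inductive pres_eq (I : Type) (R : set (word I)) : word I -> word I -> Prop :=
| pres_refl u : pres_eq R u u
| pres_sym u v : pres_eq R u v -> pres_eq R v u
| pres_trans u v w : pres_eq R u v -> pres_eq R v w -> pres_eq R u w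
| pres_ctx a b u v : pres_eq R u v -> pres_eq R (a ++ u ++ b) (a ++ v ++ b)
| pres_cancel x b : pres_eq R [:: (x, b); (x, ~~ b)] [::]
| pres_rel r : R r -> pres_eq R r [::].

Section Presentation.
Variables (I : choiceType) (R : set (word I)).

Definition pres_eqb : rel (word I) := fun u v => `[< pres_eq R u v >].

Lemma pres_eqb_refl : reflexive pres_eqb.
Proof. by move=> u; apply/asboolP; exact: pres_refl. Qed.

Lemma pres_eqb_sym : symmetric pres_eqb.
Proof. by move=> u v; apply/asboolP/asboolP => /pres_sym. Qed.

Lemma pres_eqb_trans : transitive pres_eqb.
Proof.
by move=> v u w /asboolP uv /asboolP vw; apply/asboolP; exact: pres_trans uv vw.
Qed.

Canonical pres_equiv := EquivRel pres_eqb pres_eqb_refl pres_eqb_sym pres_eqb_trans.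

Definition presented_group : Type := {eq_quot pres_equiv}.
Local Notation G := presented_group.

HB.instance Definition _ := Choice.on G.
HB.instance Definition _ := Quotient.on G.

Definition word_class (w : word I) : G := \pi_G w.

Lemma word_classP u v : word_class u = word_class v <-> pres_eq R u v.
Proof.
split=> [uv|uv]; last by apply/eqmodP; exact/asboolP.
by apply/asboolP; move/eqmodP: uv.
Qed.

Lemma word_class_repr (x : G) : word_class (repr x) = x.
Proof. exact: reprK. Qed.

Lemma pres_eq_cat u u' v v' :
  pres_eq R u u' -> pres_eq R v v' -> pres_eq R (u ++ v) (u' ++ v').
Proof.
move=> uu' vv'; apply: (@pres_trans _ _ _ (u' ++ v)).
  exact: (pres_ctx [::] v uu').
by have := pres_ctx u' [::] vv'; rewrite !cats0.
Qed.

Lemma word_invK : involutive (@word_inv I).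
Proof.
move=> w; rewrite /word_inv map_rev revK -map_comp -[RHS]map_id.
by apply: eq_map => -[x b] /=; rewrite negbK.
Qed.

Lemma pres_eq_mulV w : pres_eq R (w ++ word_inv w) [::].
Proof.
elim: w => [|[x b] w IHw]; first exact: pres_refl.
rewrite /word_inv map_cons rev_cons -cats1 /= -cat_cons.
have := pres_ctx [:: (x, b)] [:: (x, ~~ b)] IHw; rewrite /= -catA => h.
exact: pres_trans h (pres_cancel _ _ _).
Qed.

Lemma pres_eq_mulVw w : pres_eq R (word_inv w ++ w) [::].
Proof. by have := pres_eq_mulV (word_inv w); rewrite word_invK. Qed.

Lemma pres_eq_inv u v : pres_eq R u v -> pres_eq R (word_inv u) (word_inv v).
Proof.
move=> uv; apply: (@pres_trans _ _ _ (word_inv u ++ v ++ word_inv v)).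
  apply: pres_sym; rewrite -[X in pres_eq _ _ X]cats0.
  exact: pres_eq_cat (pres_refl _ _) (pres_eq_mulV v).
rewrite catA -[X in pres_eq _ _ X]cat0s; apply: pres_eq_cat (pres_refl _ _).
apply: pres_trans (pres_eq_mulVw u).
exact: pres_eq_cat (pres_refl _ _) (pres_sym uv).
Qed.

Definition pres_mul (x y : G) : G := word_class (repr x ++ repr y).
Definition pres_inv (x : G) : G := word_class (word_inv (repr x)).
Definition pres_one : G := word_class [::].

Lemma pres_mulE u v :
  pres_mul (word_class u) (word_class v) = word_class (u ++ v).
Proof.
by apply/word_classP; apply: pres_eq_cat; apply/word_classP;
  exact: word_class_repr.
Qed.

Lemma pres_invE u : pres_inv (word_class u) = word_class (word_inv u).
Proof.
by apply/word_classP; apply: pres_eq_inv; apply/word_classP;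
  exact: word_class_repr.
Qed.

Lemma pres_mulA : associative pres_mul.
Proof.
move=> x y z; rewrite -(word_class_repr x) -(word_class_repr y).
by rewrite -(word_class_repr z) !pres_mulE catA.
Qed.

Lemma pres_mul1 : left_id pres_one pres_mul.
Proof. by move=> x; rewrite -(word_class_repr x) pres_mulE. Qed.

Lemma pres_mulr1 : right_id pres_one pres_mul.
Proof. by move=> x; rewrite -(word_class_repr x) pres_mulE cats0. Qed.

Lemma pres_mulVg : left_inverse pres_one pres_inv pres_mul.
Proof.
move=> x; rewrite -(word_class_repr x) pres_invE pres_mulE.
by apply/word_classP; exact: pres_eq_mulVw.
Qed.

Lemma pres_mulgV : right_inverse pres_one pres_inv pres_mul.
Proof.
move=> x; rewrite -(word_class_repr x) pres_invE pres_mulE.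
by apply/word_classP; exact: pres_eq_mulV.
Qed.

HB.instance Definition _ := isGroup.Build G
  pres_mulA pres_mul1 pres_mulr1 pres_mulVg pres_mulgV.

Definition pres_gen (x : I) : G := word_class [:: (x, false)].

End Presentation.

HB.mixin Record isTopologicalGroup G of Group G & Topological G := {
  mulg_continuous : continuous (fun x : G * G => x.1 * x.2);
  invg_continuous : continuous (fun x : G => x^-1)
}.

#[short(type="topologicalGroupType")]
HB.structure Definition TopologicalGroup :=
  {G of Group G & Topological G & isTopologicalGroup G}.

Section UniformLattice.
Variables (Gamma : groupType) (G : topologicalGroupType).
Variable phi : UMagmaMorphism.type Gamma G.

Definition lcoset_rel : rel G := fun g h => `[< exists x, h = g * phi x >].

Lemma lcoset_rel_refl : reflexive lcoset_rel.
Proof. by move=> g; apply/asboolP; exists 1; rewrite gmulf1 mulg1. Qed.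

Lemma lcoset_rel_sym : symmetric lcoset_rel.
Proof.
have sym g h : lcoset_rel g h -> lcoset_rel h g.
  move=> /asboolP[x ->]; apply/asboolP; exists x^-1.
  by rewrite -mulgA -gmulfM mulgV gmulf1 mulg1.
by move=> g h; apply/idP/idP; exact: sym.
Qed.

Lemma lcoset_rel_trans : transitive lcoset_rel.
Proof.
move=> h g k /asboolP[x ->] /asboolP[y ->]; apply/asboolP.
by exists (x * y); rewrite gmulfM mulgA.
Qed.

Canonical lcoset_equiv :=
  EquivRel lcoset_rel lcoset_rel_refl lcoset_rel_sym lcoset_rel_trans.

(* [G / phi(Gamma)] with the quotient topology. *)
Definition coset_space : topologicalType :=
  quotient_topology {eq_quot lcoset_equiv}.

(* [phi] identifies [Gamma] with a discrete cocompact subgroup of [G]. *)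
Definition uniform_lattice_embedding : Prop :=
  [/\ injective phi,
      range phi `<=` isolated (range phi)
    & compact [set: coset_space]].

End UniformLattice.

Definition is_uniform_lattice (Gamma : groupType) (G : topologicalGroupType) :
    Prop :=
  exists phi : UMagmaMorphism.type Gamma G,
    uniform_lattice_embedding phi.

(* In a Coxeter matrix the entry 0 stands for infinity. *)
Definition coxeter_relators (I : choiceType) (M : I -> I -> nat) :
    set (word I) :=
  [set r | exists s t, r = flatten (nseq (M s t) [:: (s, false); (t, false)])].

Definition coxeter_group (I : choiceType) (M : I -> I -> nat) : groupType :=
  presented_group (coxeter_relators M).

Definition coxeter_gen (I : choiceType) (M : I -> I -> nat) (s : I) :
    coxeter_group M := pres_gen (coxeter_relators M) s.

Definition A2tilde (s t : 'I_3) : nat := if s == t then 1%N else 3%N.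

Section CoxeterLength.
Variables (I : choiceType) (M : I -> I -> nat).

Definition expressible (w : coxeter_group M) (n : nat) : Prop :=
  exists2 e : seq I, size e = n & w = \prod_(s <- e) coxeter_gen M s.

Definition has_length (w : coxeter_group M) (n : nat) : Prop :=
  expressible w n /\ forall m, expressible w m -> (n <= m)%N.

End CoxeterLength.

(* W-metric definition of buildings (Abramenko-Brown, Buildings, Def. 5.1);
   [wdist] is the Weyl distance. *)
Record building (I : finType) (M : I -> I -> nat) := Building {
  chamber :> choiceType;
  wdist : chamber -> chamber -> coxeter_group M;
  chamber_inhabited : inhabited chamber;
  wdist_eq1 : forall C D, wdist C D = 1 <-> C = D;
  wdist_adj : forall s C C' D, wdist C' C = coxeter_gen M s ->
    wdist C' D = coxeter_gen M s * wdist C D \/ wdist C' D = wdist C D;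
  wdist_adj_reduced : forall s C C' D n, wdist C' C = coxeter_gen M s ->
    has_length (wdist C D) n ->
    has_length (coxeter_gen M s * wdist C D) n.+1 ->
    wdist C' D = coxeter_gen M s * wdist C D;
  wdist_ex : forall s C D, exists C', wdist C' C = coxeter_gen M s /\
    wdist C' D = coxeter_gen M s * wdist C D
}.

Section Building.
Variables (I : finType) (M : I -> I -> nat) (X : building M).

Definition s_adjacent (s : I) (C D : X) : Prop := wdist C D = coxeter_gen M s.

(* The panel of cotype [s] of [C] is [C] together with its s-adjacent
   chambers. *)
Definition thick : Prop := forall s (C : X),
  exists D E, [/\ s_adjacent s C D, s_adjacent s C E & D <> E].

Definition locally_finite : Prop := forall s (C : X),
  finite_set [set D | s_adjacent s C D].

(* Simplicial automorphisms of [X]; they need not preserve types, but permute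
   them. *)
Definition is_automorphism (f : X -> X) : Prop :=
  bijective f /\ exists tau : {perm I},
    forall s C D, s_adjacent s C D <-> s_adjacent (tau s) (f C) (f D).

Lemma is_automorphism_id : is_automorphism idfun.
Proof. by split; [exists idfun | exists 1 => s C D; rewrite perm1]. Qed.

Lemma is_automorphism_comp f g :
  is_automorphism f -> is_automorphism g -> is_automorphism (f \o g).
Proof.
move=> [bf [tau ftau]] [bg [ups gups]]; split; first exact: bij_comp.
by exists (ups * tau) => s C D; rewrite permM gups ftau.
Qed.

Lemma is_automorphism_inv f g : is_automorphism f ->
  cancel f g -> cancel g f -> is_automorphism g.
Proof.
move=> [bf [tau ftau]] fK gK; split; first by exists f.
by exists tau^-1 => s C D; rewrite (ftau (tau^-1 s)) permKV !gK.
Qed.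

Definition aut : Type := {f : X -> X | `[< is_automorphism f >]}.
HB.instance Definition _ := SubChoice.on aut.

Lemma autP (f : aut) : is_automorphism (val f).
Proof. exact/asboolP/(valP f). Qed.

Definition mk_aut (f : X -> X) (hf : is_automorphism f) : aut :=
  exist _ f (asboolT hf).

Lemma aut_inverse (f : aut) :
  exists g : aut, cancel (val f) (val g) /\ cancel (val g) (val f).
Proof.
have [[g fK gK] _] := autP f.
by exists (mk_aut (is_automorphism_inv (autP f) fK gK)).
Qed.

Definition aut_one : aut := mk_aut is_automorphism_id.
Definition aut_mul (f g : aut) : aut :=
  mk_aut (is_automorphism_comp (autP f) (autP g)).
Definition aut_inv (f : aut) : aut := sval (cid (aut_inverse f)).

Lemma aut_invK (f : aut) : cancel (val f) (val (aut_inv f)).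
Proof. by rewrite /aut_inv; case: cid => g []. Qed.

Lemma aut_invKV (f : aut) : cancel (val (aut_inv f)) (val f).
Proof. by rewrite /aut_inv; case: cid => g []. Qed.

Lemma aut_mulA : associative aut_mul.
Proof. by move=> f g h; exact: val_inj. Qed.
Lemma aut_mul1 : left_id aut_one aut_mul.
Proof. by move=> f; exact: val_inj. Qed.
Lemma aut_mulr1 : right_id aut_one aut_mul.
Proof. by move=> f; exact: val_inj. Qed.
Lemma aut_mulVg : left_inverse aut_one aut_inv aut_mul.
Proof. by move=> f; apply/val_inj/funext => C /=; exact: aut_invK. Qed.
Lemma aut_mulgV : right_inverse aut_one aut_inv aut_mul.
Proof. by move=> f; apply/val_inj/funext => C /=; exact: aut_invKV. Qed.

HB.instance Definition _ := isGroup.Build aut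
  aut_mulA aut_mul1 aut_mulr1 aut_mulVg aut_mulgV.

(* The permutation topology on [aut]: pointwise convergence on chambers. *)
Definition aut_fun (f : aut) : {ptws X -> discrete_topology X} := val f.
HB.instance Definition _ := Topological.copy aut (initial_topology aut_fun).

Lemma near_aut (f : aut) (C : X) : \forall g \near f, val g C = val f C.
Proof.
pose pr := @proj X (fun=> discrete_topology X) C.
have cpr : continuous (pr \o aut_fun : aut -> discrete_topology X).
  move=> g; apply: (@continuous_comp aut {ptws X -> discrete_topology X} _).
    exact: initial_continuous.
  exact: proj_continuous.
exact: (cpr f [set val f C] (discrete_set1 _)).
Qed.

Lemma cvg_aut (F : set_system aut) (f : aut) : Filter F ->
  (forall C, \forall g \near F, val g C = val f C) -> F --> f.
Proof.
move=> FF Ff A; rewrite nbhsE => -[_ [[V oV <-] Vf] VA].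
apply: (filterS VA).
suff h : aut_fun @ F --> aut_fun f by apply: h; exact: open_nbhs_nbhs.
apply/cvg_sup => C B; rewrite nbhsE => -[_ [[W oW <-] Wf] WB].
apply: filterS WB _; apply: filterS (Ff C) => g gC.
by rewrite /= /proj /aut_fun gC.
Qed.

Lemma aut_mul_continuous : continuous (fun x : aut * aut => x.1 * x.2).
Proof.
move=> -[f g]; apply: cvg_aut => C.
exists ([set f' | val f' (val g C) = val f (val g C)],
        [set g' | val g' C = val g C]); first by split; exact: near_aut.
by move=> -[f' g'] /= [f'E g'E]; rewrite g'E.
Qed.

Lemma aut_inv_continuous : continuous (fun x : aut => x^-1).
Proof.
move=> f; apply: cvg_aut => [|C]; first exact/fmap_filter/nbhs_filter.
apply: filterS (near_aut f (val f^-1 C)) => g.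
rewrite (aut_invKV f C) => gE.
by have := aut_invK g (val f^-1 C); rewrite gE.
Qed.

HB.instance Definition _ := isTopologicalGroup.Build aut
  aut_mul_continuous aut_inv_continuous.

End Building.

Section ProjectivePlane.
Variable F : finFieldType.

Definition point : Type := {U : {vspace 'rV[F]_3} | \dim U == 1%N}.
Definition line : Type := {U : {vspace 'rV[F]_3} | \dim U == 2%N}.
Definition incident (p : point) (l : line) : bool := (val p <= val l)%VS.

Record plane_automorphism := PlaneAutomorphism {
  on_points : point -> point;
  on_lines : line -> line;
  on_points_bij : bijective on_points;
  on_lines_bij : bijective on_lines;
  on_incident : forall p l, incident (on_points p) (on_lines l) = incident p l
}.

Definition power_trivial (sigma : plane_automorphism) (k : nat) : Prop :=
  (forall p, iter k (on_points sigma) p = p) /\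
  (forall l, iter k (on_lines sigma) l = l).

(* [sigma] generates a cyclic Singer group: it has order [n], and its powers
   act transitively and freely on the points. *)
Definition singer_generator (n : nat) (sigma : plane_automorphism) : Prop :=
  [/\ forall k, power_trivial sigma k <-> (n %| k)%N,
      forall p p', exists k, iter k (on_points sigma) p = p'
    & forall k p, iter k (on_points sigma) p = p -> power_trivial sigma k].

End ProjectivePlane.

Definition singer_order (q : nat) : nat := (q ^ 2 + q + 1)%N.

(* A residue class [d : 'Z_n] is used as an exponent through its representative
   in [0, n); this is harmless since [sigma] has order [n]. *)
Definition classical_difference_set (q : nat) (D : set 'Z_(singer_order q)) :
    Prop :=
  exists F : finFieldType, #|F| = q /\
  exists (sigma : plane_automorphism F) (p : point F) (l : line F),
    singer_generator (singer_order q) sigma /\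
    D = [set d | incident p (iter d (on_lines sigma) l)].

Section Gamma2.
Variables (q : nat) (delta : 'I_3 -> 'I_q.+1 -> 'Z_(singer_order q)).

Definition gen_pow (a : 'I_3) (k : nat) : word 'I_3 := nseq k (a, false).

Definition Gamma2_relators : set (word 'I_3) :=
  [set r | (exists a, r = gen_pow a (singer_order q)) \/
           (exists j, r = gen_pow 0%R (delta 0%R j) ++
                          gen_pow 1%R (delta 1%R j) ++
                          gen_pow 2%:R%R (delta 2%:R%R j))].

Definition Gamma2 : groupType := presented_group Gamma2_relators.

End Gamma2.

(* Main.v *)
Require Import Defs.
From HB Require Import structures.
From mathcomp Require Import all_boot all_order all_algebra perm.
From mathcomp Require Import all_classical all_reals all_analysis.
From mathcomp Require Import zify ring.

(* Label the chambers around every panel by 'I_q.+1.  The label of a chamber is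
   the index j of the relation it comes from; turning about a vertex of type a
   from label j to label k moves by the difference delta a j - delta a k, so that
   the rank 2 residues are projective planes as soon as every delta a is a
   perfect difference family.

   In type A2tilde an element of the
   Weyl group W has at most two right descents, and when it has two the top of its
   weak order interval [1, w] is a hexagon.  Hence a labelling of [1, w] whose
   hexagons close up in the planes extends uniquely to [1, w s] once the new label
   is chosen.  These labelled intervals form a chamber system X on which the
   generators act by rotations, so the presented group maps to X; the chambers
   (g, j) of the group develop to X, and reading off w defines the retraction onto
   W.  Pushing galleries through hexagons shows that every chamber is reached by a
   gallery of reduced type, so that only the base chamber retracts to 1.

   The group acts freely on the chambers with finitely many orbits, and stabilizers
   of chambers in the automorphism group are compact by local finiteness. *)

Set Implicit Arguments.
Unset Strict Implicit.
Unset Printing Implicit Defensive.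

Import Order.TTheory GRing.Theory.

Local Open Scope classical_set_scope.
Local Open Scope group_scope.
Local Open Scope quotient_scope.

Local Notation W := (coxeter_group A2tilde).
Local Notation sg := (coxeter_gen A2tilde).

(** * The Coxeter group of type A2tilde *)

Lemma ord3P (P : 'I_3 -> Prop) : P 0%R -> P 1%R -> P 2%:R%R -> forall s, P s.
Proof.
move=> P0 P1 P2 [[|[|[|//]]] h].
- by rewrite (_ : Ordinal h = 0%R) //; apply/val_inj.
- by rewrite (_ : Ordinal h = 1%R) //; apply/val_inj.
- by rewrite (_ : Ordinal h = 2%:R%R) //; apply/val_inj.
Qed.

(* The third type, when [s != t]. *)
Definition third (s t : 'I_3) : 'I_3 := (- (s + t))%R.

Lemma third_table :
  (third 0%R 1%R = 2%:R%R) * (third 1%R 0%R = 2%:R%R) *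
  (third 0%R 2%:R%R = 1%R) * (third 2%:R%R 0%R = 1%R) *
  (third 1%R 2%:R%R = 0%R) * (third 2%:R%R 1%R = 0%R).
Proof. by do !split; apply/val_inj. Qed.

(* Right multiplication by [s] on the Shi coordinates of alcoves.  If (x0, x1, x2)
   are the gaps of the window of an affine permutation, whose sum is 3, then
   [k i] is the floor of [x_i / 3], and [s] sends x_s to - x_s and the other x_i
   to x_i + x_s = 3 - x_(third s i). *)
Definition shi_step (s : 'I_3) (k : 'I_3 -> int) : 'I_3 -> int :=
  fun i => (if i == s then - k s - 1 else - k (third s i))%R.

Lemma shi_stepK s : involutive (shi_step s).
Proof.
move=> k; apply/funext; elim/ord3P: s; elim/ord3P;
  rewrite /shi_step /= ?third_table /=; lia.
Qed.

Lemma shi_step_braid s t k : s != t ->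
  shi_step s (shi_step t (shi_step s k)) = shi_step t (shi_step s (shi_step t k)).
Proof.
move=> st; apply/funext; move: st; elim/ord3P: s; elim/ord3P: t => //= _;
  elim/ord3P; rewrite /shi_step /= ?third_table /=; lia.
Qed.

Section PresentedGroup.
Variables (I : choiceType) (R : set (word I)).
Local Notation G := (presented_group R).
Local Notation cls := (word_class R).

Lemma word_class_cat u v : cls (u ++ v) = cls u * cls v :> G.
Proof. by rewrite [RHS]pres_mulE. Qed.

Lemma word_class_inv x : cls [:: (x, true)] = (pres_gen R x)^-1 :> G.
Proof. by rewrite [RHS]pres_invE. Qed.

Lemma word_class_rel r : R r -> cls r = 1.
Proof. by move=> Rr; apply/word_classP; apply: pres_rel. Qed.

Lemma word_class_nseq x m : cls (nseq m (x, false)) = pres_gen R x ^+ m :> G.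
Proof.
elim: m => [|m IHm]; first by rewrite expg0.
by rewrite expgS -IHm -word_class_cat.
Qed.

Lemma word_class_flatten u m : cls (flatten (nseq m u)) = cls u ^+ m :> G.
Proof. by elim: m => [|m IHm] //=; rewrite word_class_cat IHm expgS. Qed.

Lemma presented_group_ind (P : G -> Prop) :
  P 1 -> (forall g x, P g -> P (g * pres_gen R x)) ->
  (forall g x, P g -> P (g * (pres_gen R x)^-1)) -> forall g, P g.
Proof.
move=> P1 Pg PV g; rewrite -[g]word_class_repr.
elim/last_ind: (repr g) => [//|u [x b] IHu].
rewrite -cats1 word_class_cat; case: b; last exact: Pg.
by rewrite word_class_inv; exact: PV.
Qed.

End PresentedGroup.

Lemma sg_sq s : sg s * sg s = 1.
Proof.
rewrite -word_class_cat; apply: word_class_rel.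
by exists s, s; rewrite /A2tilde eqxx.
Qed.

Lemma sgV s : (sg s)^-1 = sg s.
Proof. by apply/(mulgI (sg s)); rewrite mulgV sg_sq. Qed.

Lemma sgK s : involutive (fun w : W => w * sg s).
Proof. by move=> w; rewrite -mulgA sg_sq mulg1. Qed.

Lemma sg_braid s t : s != t -> sg s * sg t * sg s = sg t * sg s * sg t.
Proof.
move=> st; apply/(mulIg (sg t * sg s * sg t)).
have -> : sg t * sg s * sg t * (sg t * sg s * sg t) = 1 :> W.
  by rewrite !mulgA !sgK sg_sq.
have : word_class (coxeter_relators A2tilde)
  (flatten (nseq 3 [:: (s, false); (t, false)])) = 1.
  by apply: word_class_rel; exists s, t; rewrite /A2tilde (negbTE st).
rewrite word_class_flatten (word_class_cat _ [:: _] [:: _]) => <-.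
by rewrite !expgS expg0 mulg1 !mulgA.
Qed.

Lemma cox_ind (P : W -> Prop) :
  P 1 -> (forall w s, P w -> P (w * sg s)) -> forall w, P w.
Proof.
by move=> P1 Ps; apply: presented_group_ind => // w s Pw;
  rewrite ?sgV; exact: Ps.
Qed.

(** The sign of a letter is ignored, since the generators are involutions. *)
Definition shi_word (u : word 'I_3) (k : 'I_3 -> int) : 'I_3 -> int :=
  foldl (fun k l => shi_step l.1 k) k u.

Lemma shi_word_pres u v : pres_eq (coxeter_relators A2tilde) u v ->
  shi_word u =1 shi_word v.
Proof.
elim=> {u v} //.
- by move=> u v _ IH k; rewrite IH.
- by move=> u v w _ IH _ IH' k; rewrite IH.
- by move=> a b u v _ IH k; rewrite /shi_word !foldl_cat -!/(shi_word _ _) IH.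
- by move=> x b k; rewrite /shi_word /= shi_stepK.
move=> r [s [t ->]] k; rewrite /A2tilde; have [<-|st] := eqVneq s t.
  by rewrite /shi_word /= shi_stepK.
rewrite /shi_word /=.
by rewrite (shi_step_braid _ st) !shi_stepK.
Qed.

Definition shi (w : W) : 'I_3 -> int := shi_word (repr w) (fun=> 0%R).

Lemma shi_class u : shi (word_class _ u) = shi_word u (fun=> 0%R).
Proof. by apply: shi_word_pres; apply/word_classP; rewrite word_class_repr. Qed.

Lemma shi1 : shi 1 = fun=> 0%R.
Proof. exact: (shi_class [::]). Qed.

Lemma shiM w s : shi (w * sg s) = shi_step s (shi w).
Proof.
rewrite -[w]word_class_repr -word_class_cat !shi_class /shi_word.
by rewrite foldl_cat.
Qed.

(** Shi's length formula: the absolute value of [shi w i] counts the walls of the i-th direction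
    that separate the alcove of [w] from the fundamental one. *)
Definition len (w : W) : nat :=
  (`|shi w 0%R| + `|shi w 1%R| + `|shi w 2%:R%R|)%N.

Definition dsc (w : W) (s : 'I_3) : bool := (shi w s < 0)%R.

(** The numbers x_i / 3 sum to 1 and are not integers, so their fractional parts sum to 1 or 2.
    Given this constraint, the facts on descents below are linear arithmetic. *)
Lemma shi_sum w : let m := (shi w 0 + shi w 1 + shi w 2%:R)%R in
  (m = 0 \/ m = - 1)%R.
Proof.
elim/cox_ind: w => [|w s]; rewrite ?shi1 //=; first by left; lia.
by rewrite shiM; elim/ord3P: s; rewrite /shi_step /= ?third_table; lia.
Qed.

Lemma len1 : len 1 = 0%N.
Proof. by rewrite /len shi1. Qed.

Lemma len_asc w s : ~~ dsc w s -> len (w * sg s) = (len w).+1.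
Proof.
rewrite /dsc /len shiM; have := shi_sum w.
by elim/ord3P: s; rewrite /shi_step /= ?third_table; lia.
Qed.

Lemma len_dsc w s : dsc w s -> len w = (len (w * sg s)).+1.
Proof.
rewrite /dsc /len shiM; have := shi_sum w.
by elim/ord3P: s; rewrite /shi_step /= ?third_table; lia.
Qed.

Lemma dscM w s : dsc (w * sg s) s = ~~ dsc w s.
Proof. by rewrite /dsc shiM /shi_step eqxx; lia. Qed.

(** After [s] the t-gap is x_s + x_t, and after [s], [t] the s-gap is x_t: both keep the common sign
    of x_s and x_t. The same holds for ascents. *)
Lemma dsc_braid w s t : s != t -> dsc w s -> dsc w t ->
  dsc (w * sg s) t /\ dsc (w * sg s * sg t) s.
Proof.
rewrite /dsc !shiM; have := shi_sum w.
by elim/ord3P: s; elim/ord3P: t => //=; rewrite /shi_step /= ?third_table; lia.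
Qed.

Lemma asc_braid w s t : s != t -> ~~ dsc w s -> ~~ dsc w t ->
  ~~ dsc (w * sg s) t /\ ~~ dsc (w * sg s * sg t) s.
Proof.
rewrite /dsc !shiM; have := shi_sum w.
by elim/ord3P: s; elim/ord3P: t => //=; rewrite /shi_step /= ?third_table; lia.
Qed.

(** Three negative coordinates would sum to at most - 3. *)
Lemma dsc_at_most_two w s t u :
  dsc w s -> dsc w t -> s != t -> dsc w u -> (u == s) || (u == t).
Proof.
rewrite /dsc; have := shi_sum w.
by elim/ord3P: s; elim/ord3P: t; elim/ord3P: u => //=; lia.
Qed.

Lemma no_dsc w : (forall s, ~~ dsc w s) -> len w = 0%N.
Proof.
move=> h; have := h 0%R; have := h 1%R; have := h 2%:R%R; have := shi_sum w.
by rewrite /dsc /len; lia.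
Qed.

(** * Galleries of reduced type *)

Section Reach.
Variables (T : Type) (adj : 'I_3 -> T -> T -> Prop) (c : T).
Hypothesis adj_braid : forall s t D0 D1 D2 D3, s != t ->
  adj s D0 D1 -> adj t D1 D2 -> adj s D2 D3 ->
  exists E1 E2, [/\ adj t D0 E1, adj s E1 E2 & adj t E2 D3].
Hypothesis adj_panel : forall s D E F, adj s D E -> adj s E F ->
  D = F \/ adj s D F.

(** Stated for any chamber system with braid moves, because it serves twice: on [W] itself it yields
    reduced words, and on the chambers of the group it shows that reduced galleries lead
    everywhere. *)
Inductive reach : W -> T -> Prop :=
| reach1 : reach 1 c
| reachM w s D E : reach w D -> ~~ dsc w s -> adj s D E -> reach (w * sg s) E.

(** If the gallery ends with [t] instead of [s], both are descents and [w] ends with the longest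
    word in them. Peeling [s] and then [t] off the shorter gallery exposes a path of type t, s, t,
    which a braid move turns into s, t, s. *)
Lemma reach_dsc w s E : reach w E -> dsc w s ->
  exists2 D, reach (w * sg s) D & adj s D E.
Proof.
have [m] := ubnP (len w); elim: m w s E => // m IHm w s E + rwE.
case: rwE => [|v t D F vD nvt DF wm ws]; first by rewrite /dsc shi1.
have [<-|ts] := eqVneq t s; first by exists D; rewrite ?sgK.
have st : s != t by rewrite eq_sym.
have wt : dsc (v * sg t) t by rewrite dscM.
have [+ +] := dsc_braid ts wt ws; rewrite sgK => vs vst.
have [_ vtst] := dsc_braid st ws wt.
have nvst : ~~ dsc (v * sg s * sg t) t by rewrite dscM vst.
have vE : v * sg s * sg t * sg s = v * sg t * sg s * sg t.
  by rewrite -2!mulgA (mulgA (sg s)) sg_braid // !mulgA.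
have nvsts : ~~ dsc (v * sg s * sg t) s by rewrite -dscM vE.
have [nvstst _] := asc_braid st nvsts nvst.
have lv := len_dsc wt; have lvs := len_dsc vs; rewrite sgK in lv.
have [|D4 rD4 D4D] := IHm v s D _ vD vs; first by rewrite lv in wm.
have [|D5 rD5 D54] := IHm _ t D4 _ rD4 vst.
  by rewrite lv lvs in wm; exact: ltnW.
have [E1 [E2 [D5E1 E12 E2F]]] := adj_braid ts D54 D4D DF.
exists E2 => //; rewrite -[_ * sg s](sgK t) -vE.
by apply: reachM E12 => //; apply: reachM D5E1.
Qed.

Lemma reach_adj w s D E : reach w D -> adj s D E -> exists v, reach v E.
Proof.
move=> wD DE; have [ws|ws] := boolP (dsc w s); last first.
  by exists (w * sg s); exact: reachM DE.
have [F wF FD] := reach_dsc wD ws.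
have [<-|FE] := adj_panel FD DE; first by exists (w * sg s).
by exists (w * sg s * sg s); apply: reachM FE => //; rewrite dscM ws.
Qed.

End Reach.

Lemma cox_reach w : reach (fun s v v' => v' = v * sg s) 1 w w.
Proof.
have rE v v' : reach (fun s v v' => v' = v * sg s) 1 v v' -> v = v'.
  by elim=> // x s D E _ -> _ ->.
suff [v rv] : exists v, reach (fun s v v' => v' = v * sg s) 1 v w.
  by have vw := rE _ _ rv; rewrite vw in rv.
elim/cox_ind: w => [|w s [v vw]]; first by exists 1; exact: reach1.
apply: (reach_adj _ _ vw) (erefl (w * sg s)).
- move=> {}s t D0 D1 D2 D3 st -> -> ->.
  exists (D0 * sg t), (D0 * sg t * sg s); split=> //.
  by rewrite -2!mulgA (mulgA (sg s)) sg_braid // !mulgA.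
- by move=> {}s D E F -> ->; left; rewrite sgK.
Qed.

Lemma reduced_word w :
  exists2 e : seq 'I_3, size e = len w & w = \prod_(s <- e) sg s.
Proof.
have [D] : exists D, reach (fun s v v' => v' = v * sg s) 1 w D.
  by exists w; exact: cox_reach.
elim=> [|v s _ _ _ [e se vE] nvs _].
  by exists [::]; rewrite ?len1 ?big_nil.
exists (rcons e s).
  by rewrite size_rcons se (len_asc nvs).
by rewrite -cats1 big_cat big_seq1 /= -vE.
Qed.

Lemma len_prod (e : seq 'I_3) w :
  (len (w * \prod_(s <- e) sg s) <= len w + size e)%N.
Proof.
elim: e w => [|s e IHe] w; first by rewrite big_nil mulg1 addn0.
rewrite big_cons mulgA; apply: leq_trans (IHe _) _ => /=.
have [/len_dsc ->|/len_asc ->] := boolP (dsc w s); last by rewrite addnS.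
by rewrite -addSnnS leq_add2r ltnW.
Qed.

Lemma lenM v w : (len (v * w) <= len v + len w)%N.
Proof. by have [e <- {1}->] := reduced_word w; exact: len_prod. Qed.

Lemma len_eq0 w : len w = 0%N -> w = 1.
Proof.
by have [e <- ->] := reduced_word w => /size0nil ->; rewrite big_nil.
Qed.

(** Ties the length in the building axioms to the Shi coordinates. *)
Lemma has_lengthE w n : has_length w n <-> n = len w.
Proof.
have lb m : expressible w m -> (len w <= m)%N.
  move=> [e <- ->]; have := len_prod e 1.
  by rewrite len1 mul1g.
have ex : expressible w (len w) by have [e] := reduced_word w; exists e.
split=> [[wn nmin]|->]; last by split.
by apply/eqP; rewrite eqn_leq lb // nmin.
Qed.

(** * The weak order *)

Definition quo (x y : W) : W := x^-1 * y.

Lemma quoM x y s : quo x (y * sg s) = quo x y * sg s.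
Proof. by rewrite /quo mulgA. Qed.

Lemma len_quo x y : (len y <= len x + len (quo x y))%N.
Proof. by have := lenM x (quo x y); rewrite /quo mulVKg. Qed.

Lemma quo_trans x y z : (len (quo x z) <= len (quo x y) + len (quo y z))%N.
Proof. by have := lenM (quo x y) (quo y z); rewrite /quo -mulgA mulVKg. Qed.

Lemma quo_eq x y : len (quo x y) = 0%N -> x = y.
Proof. by move/len_eq0 => xy; rewrite -[y](mulVKg x) -/(quo x y) xy mulg1. Qed.

(* The right weak order: [x] lies on a shortest gallery from 1 to [y]. *)
Definition weak (x y : W) : bool := (len x + len (quo x y) == len y)%N.

Lemma weak_refl x : weak x x.
Proof. by rewrite /weak /quo mulVg len1 addn0. Qed.

Lemma weak1 x : weak 1 x.
Proof. by rewrite /weak /quo len1 invg1 mul1g. Qed.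

Lemma weak_trans y x z : weak x y -> weak y z -> weak x z.
Proof.
rewrite /weak => /eqP xy /eqP yz.
by have := len_quo x z; have := quo_trans x y z; lia.
Qed.

Lemma weak_asc x s : ~~ dsc x s -> weak x (x * sg s).
Proof.
move=> xs; rewrite /weak /quo mulKg len_asc //.
have := @len_asc 1 s; rewrite mul1g len1 => ->; first by rewrite addn1.
by rewrite /dsc shi1.
Qed.

Lemma weak_dsc y s : dsc y s -> weak (y * sg s) y.
Proof.
by move=> ys; rewrite -{2}[y](sgK s) weak_asc // dscM ys.
Qed.

Lemma weak_len x y : weak x y -> (len x <= len y)%N.
Proof. by move=> /eqP <-; rewrite leq_addr. Qed.

(** By additivity of lengths, a right descent of [quo x y] is one of [y] too, and removing it stays
    above [x]. *)
Lemma weak_case x y : weak x y -> x = y \/ exists2 s, dsc y s & weak x (y * sg s).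
Proof.
rewrite /weak => /eqP xy.
have [[s zs]|nz] := pselect (exists s, dsc (quo x y) s); last first.
  by left; apply/quo_eq/no_dsc => s; apply/negP => zs; apply: nz; exists s.
right; have lz := len_dsc zs; have := len_quo x (y * sg s); rewrite quoM => lys.
have ys : dsc y s by apply: contraT => /len_asc; lia.
by exists s => //; rewrite quoM; have := len_dsc ys; lia.
Qed.

Lemma weak_quo_dsc x y s : dsc y s -> weak x (y * sg s) -> dsc (quo x y) s.
Proof.
move=> ys xs; have := weak_trans xs (weak_dsc ys); move: xs.
rewrite /weak quoM => /eqP e1 /eqP e2; apply: contraT => /len_asc e3.
by have := len_dsc ys; lia.
Qed.

(** Both [s] and [t] are descents of [quo x y], so going down the hexagon shortens [quo x y] by 3,
    as it does [y]. *)
Lemma weak_meet x y s t : s != t -> dsc y s -> dsc y t ->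
  weak x (y * sg s) -> weak x (y * sg t) -> weak x (y * sg s * sg t * sg s).
Proof.
move=> st ys yt xs xt.
have zs := weak_quo_dsc ys xs; have zt := weak_quo_dsc yt xt.
have := weak_trans xs (weak_dsc ys).
have [zs1 zs2] := dsc_braid st zs zt; have [ys1 ys2] := dsc_braid st ys yt.
rewrite /weak !quoM (len_dsc zs) (len_dsc zs1) (len_dsc zs2).
by rewrite (len_dsc ys) (len_dsc ys1) (len_dsc ys2) !addnS !eqSS.
Qed.

(** * Labelled intervals *)

Lemma third_sym s t : third s t = third t s.
Proof. by rewrite /third addrC. Qed.

Lemma sgM_braid (x : W) s t : s != t ->
  x * sg s * sg t * sg s = x * sg t * sg s * sg t.
Proof. by move=> st; rewrite -2!mulgA (mulgA (sg s)) sg_braid // !mulgA. Qed.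

Lemma dsc_hexagon y s t : s != t -> dsc y s -> dsc y t ->
  exists x, [/\ ~~ dsc x s, ~~ dsc x t & y = x * sg s * sg t * sg s].
Proof.
move=> st ys yt; have ts : t != s by rewrite eq_sym.
have [yst ysts] := dsc_braid st ys yt; have [_ ytst] := dsc_braid ts yt ys.
exists (y * sg s * sg t * sg s); split.
- by rewrite dscM ysts.
- by rewrite (sgM_braid _ st) dscM ytst.
- by rewrite !sgK.
Qed.

Lemma hexagon_weak (x : W) s t : s != t -> ~~ dsc x s -> ~~ dsc x t ->
  [/\ weak x (x * sg s), weak (x * sg s) (x * sg s * sg t)
    & weak (x * sg s * sg t) (x * sg s * sg t * sg s)].
Proof.
by move=> st xs xt; have [h1 h2] := asc_braid st xs xt; split; exact: weak_asc.
Qed.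

(** * Perfect difference families and good labellings *)

Section DifferenceFamily.
Variables (V : comNzRingType) (J : choiceType) (delta : 'I_3 -> J -> V).

Definition perfect_difference (d : J -> V) : Prop :=
  (forall a, exists jk, d jk.1 - d jk.2 = a)%R /\
  (forall j k j' k', d j - d k = d j' - d k' -> j != k -> j = j' /\ k = k')%R.

Hypothesis delta_diff : forall a, perfect_difference (delta a).

(* The labels met along a hexagon around a vertex of type [a], starting in either
   direction; moves in one of the two panel types do not contribute. *)
Definition hex (a : 'I_3) (j0 j1 j2 j3 j4 j5 : J) : Prop :=
  (delta a j1 + delta a j3 + delta a j5 = delta a j0 + delta a j2 + delta a j4)%R.

(** Leaves to [ring] the check that an equation is a rewriting of a known one. *)
Lemma eq_lin (a b c d : V) : (c = d -> a - b = c - d -> a = b)%R.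
Proof. by move=> ->; rewrite subrr => /eqP; rewrite subr_eq0 => /eqP. Qed.

Lemma diff_inj a j k j' k' : (delta a j - delta a k = delta a j' - delta a k')%R ->
  j != k -> j = j' /\ k = k'.
Proof. exact: (delta_diff a).2. Qed.

Lemma diff_surj a v : exists jk, (delta a jk.1 - delta a jk.2 = v)%R.
Proof. exact: (delta_diff a).1. Qed.

Lemma diff_eq0 a j k : (delta a j - delta a k = 0)%R -> j = k.
Proof.
move=> jk; have [//|njk] := eqVneq j k; exfalso.
have [|_ kj] := @diff_inj a j k j j _ njk; first by rewrite jk subrr.
by rewrite kj eqxx in njk.
Qed.

Lemma hex_rev a j0 j1 j2 j3 j4 j5 :
  hex a j0 j1 j2 j3 j4 j5 -> hex a j0 j5 j4 j3 j2 j1.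
Proof. by rewrite /hex => h; apply: (eq_lin h); ring. Qed.

(** The pair [j4], [j5] represents the difference that the equation leaves over. If two neighbouring
    labels coincided, uniqueness of differences would force one of the given inequalities to
    fail. *)
Lemma hex_solve a j0 j1 j2 j3 : j0 != j1 -> j1 != j2 -> j2 != j3 ->
  exists j4 j5, [/\ j3 != j4, j4 != j5, j5 != j0 & hex a j0 j1 j2 j3 j4 j5].
Proof.
move=> n01 n12 n23.
have [[j4 j5] /= e] :=
  diff_surj a (delta a j1 - delta a j2 + delta a j3 - delta a j0)%R.
exists j4, j5; split.
- apply/eqP => j34; rewrite -j34 in e.
  have [|h _] := @diff_inj a j1 j2 j0 j5 _ n12; last by rewrite h eqxx in n01.
  by apply: (eq_lin (esym e)); ring.
- apply/eqP => j45; rewrite j45 subrr in e.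
  have [|h _] := @diff_inj a j1 j2 j0 j3 _ n12; last by rewrite h eqxx in n01.
  by apply: (eq_lin (esym e)); ring.
- apply/eqP => j50; rewrite j50 in e.
  have [|_ h] := @diff_inj a j1 j2 j4 j3 _ n12; last by rewrite h eqxx in n23.
  by apply: (eq_lin (esym e)); ring.
- by apply: (eq_lin (esym e)); ring.
Qed.

Lemma hex_uniq a j0 j1 j2 j3 j4 j5 j4' j5' : j4 != j5 ->
  hex a j0 j1 j2 j3 j4 j5 -> hex a j0 j1 j2 j3 j4' j5' -> j4 = j4' /\ j5 = j5'.
Proof.
move=> n45 h h'; apply: (@diff_inj a) n45.
by rewrite /hex in h h';
  apply: (eq_lin (etrans (f_equal2 +%R h' (esym h)) (addrC _ _))); ring.
Qed.

Definition good (w : W) (f : W -> J) : Prop :=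
  (forall x s, ~~ dsc x s -> weak (x * sg s) w -> f x != f (x * sg s)) /\
  (forall x s t, s != t -> ~~ dsc x s -> ~~ dsc x t ->
     weak (x * sg s * sg t * sg s) w ->
     hex (third s t) (f x) (f (x * sg s)) (f (x * sg s * sg t))
       (f (x * sg s * sg t * sg s)) (f (x * sg t * sg s)) (f (x * sg t))).

Definition agree (w : W) (f f' : W -> J) : Prop := forall x, weak x w -> f x = f' x.

Lemma agree_sym w f f' : agree w f f' -> agree w f' f.
Proof. by move=> h x xw; rewrite h. Qed.

Lemma agree_weak v w f f' : weak v w -> agree w f f' -> agree v f f'.
Proof. by move=> vw h x xv; rewrite h //; exact: weak_trans xv vw. Qed.

Lemma good_weak v w f : weak v w -> good w f -> good v f.
Proof.
move=> vw [f1 f2]; split=> [x s xs xv|x s t st xs xt xv].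
  by apply: f1 => //; exact: weak_trans xv vw.
by apply: f2 => //; exact: weak_trans xv vw.
Qed.

Lemma good_agree w f f' : agree w f f' -> good w f -> good w f'.
Proof.
move=> ff' [f1 f2]; split=> [x s xs xw|x s t st xs xt xw].
  rewrite -!ff' //; first exact: f1.
  exact: weak_trans (weak_asc xs) xw.
have ts : t != s by rewrite eq_sym.
have [h1 h2 h3] := hexagon_weak st xs xt; have [g1 g2 g3] := hexagon_weak ts xt xs.
rewrite -(sgM_braid x st) in g3.
have h3w := weak_trans h3 xw; have h2w := weak_trans h2 h3w.
have g3w := weak_trans g3 xw; have g2w := weak_trans g2 g3w.
by rewrite -!ff' //; [exact: f2|exact: weak_trans h1 h2w].
Qed.

(** Whatever lies strictly below [y] lies below some [y * sg u], so only edges and hexagons with top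
    [y] need a check. *)
Lemma good_glue y f : (forall u, dsc y u -> good (y * sg u) f) ->
  (forall u, dsc y u -> f (y * sg u) != f y) ->
  (forall x s t, s != t -> ~~ dsc x s -> ~~ dsc x t -> y = x * sg s * sg t * sg s ->
     hex (third s t) (f x) (f (x * sg s)) (f (x * sg s * sg t))
       (f y) (f (x * sg t * sg s)) (f (x * sg t))) ->
  good y f.
Proof.
move=> f1 f2 f3; split=> [x s xs /weak_case[xy|[u yu xu]]|x s t st xs xt].
- have := f2 s; rewrite -xy sgK dscM xs; exact.
- by have [+ _] := f1 _ yu; apply.
move=> /weak_case[xy|[u yu xu]]; last by have [_ +] := f1 _ yu; apply.
by rewrite xy; apply: f3.
Qed.

(** For another descent [t], four consecutive labels of the hexagon under [y] are known. [hex_uniq]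
    gives the other two, and induction climbs the other side of the hexagon. *)
Lemma good_uniq y s f f' : good y f -> good y f' -> dsc y s ->
  agree (y * sg s) f f' -> f y = f' y -> agree y f f'.
Proof.
have [m] := ubnP (len y); elim: m y s => // m IHm y s + gf gf' ys ff' fy.
move=> ly z /weak_case[->//|[t yt zt]].
have [st|st] := eqVneq s t; first by apply: ff'; rewrite st.
have ts : t != s by rewrite eq_sym.
have [x [xs xt yE]] := dsc_hexagon st ys yt.
have ytE : y * sg t = x * sg t * sg s by rewrite yE (sgM_braid x st) sgK.
have ysE : y * sg s = x * sg s * sg t by rewrite yE sgK.
have [h1 h2 h3] := hexagon_weak st xs xt; have [g1 g2 g3] := hexagon_weak ts xt xs.
have [a1 _] := asc_braid ts xt xs.
have l1 := len_asc xt; have l2 := len_asc a1; have l3 := len_dsc yt.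
rewrite ytE in zt l3; rewrite ysE in ff'.
have w1 : weak (x * sg t * sg s) y by rewrite -ytE weak_dsc.
have w2 := weak_trans g2 w1.
have hf := gf.2 x s t st xs xt; have hf' := gf'.2 x s t st xs xt.
rewrite -yE in hf hf'.
move: (hf (weak_refl y)) (hf' (weak_refl y)).
rewrite -fy -(ff' (x * sg s * sg t)) ?weak_refl // -(ff' (x * sg s)) //.
rewrite -(ff' x) => [k1 k2|]; last exact: weak_trans h2.
have [|e4 e5] := hex_uniq _ k1 k2.
  by rewrite eq_sym; apply: gf.1.
have agx : agree x f f' by apply: agree_weak ff'; exact: weak_trans h2.
have agt : agree (x * sg t) f f'.
  apply: (IHm _ t) => //; rewrite ?sgK ?dscM //.
  - by rewrite l3 l2 in ly; exact: ltnW.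
  - exact: good_weak gf.
  - exact: good_weak gf'.
apply: (IHm _ s) zt => //; rewrite ?sgK ?dscM //.
- by rewrite l3 in ly.
- exact: good_weak gf.
- exact: good_weak gf'.
Qed.

Lemma good_extend w s f j : good w f -> ~~ dsc w s -> j != f w ->
  exists f', [/\ good (w * sg s) f', agree w f' f & f' (w * sg s) = j].
Proof.
have [m] := ubnP (len w); elim: m w s f j => // m IHm w s f j lw gf ws jw.
pose y := w * sg s; have ys : dsc y s by rewrite dscM.
have ysE : y * sg s = w by rewrite /y sgK.
have nyw : ~~ weak y w.
  by apply/negP => /weak_len; rewrite /y len_asc // ltnn.
(* If [s] is the only descent of [y], no hexagon has top [y] and the new label is free. *)
have [[t [st yt]]|h] := pselect (exists t, s != t /\ dsc y t); last first.
  have ds u : dsc y u -> u = s.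
    move=> yu; have [->//|us] := eqVneq u s; exfalso; apply: h.
    by exists u; rewrite eq_sym.
  exists (fun z => if weak z w then f z else j).
  have ag : agree w (fun z => if weak z w then f z else j) f.
    by move=> z zw; rewrite zw.
  split=> //; last by rewrite -/y (negbTE nyw).
  apply: good_glue => [u /ds ->|u /ds ->|x u v uv xu xv yE].
  - by rewrite sgK; apply: good_agree gf; exact: agree_sym.
  - by rewrite sgK weak_refl -/y (negbTE nyw) eq_sym.
  have yu : u = s
    by apply: ds; rewrite -/y in yE; rewrite yE dscM (asc_braid uv xu xv).2.
  have yv : v = s.
    have vu : v != u by rewrite eq_sym.
    apply: ds; rewrite -/y in yE.
    by rewrite yE sgM_braid // dscM (asc_braid vu xv xu).2.
  by rewrite yu yv eqxx in uv.
have ts : t != s by rewrite eq_sym.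
have [x [xs xt yE]] := dsc_hexagon st ys yt.
have ytE : y * sg t = x * sg t * sg s by rewrite yE (sgM_braid x st) sgK.
have wE : w = x * sg s * sg t by rewrite -ysE yE sgK.
have [h1 h2 h3] := hexagon_weak st xs xt; have [g1 g2 g3] := hexagon_weak ts xt xs.
have xw : weak x w by rewrite wE; exact: weak_trans h2.
have [a1 _] := asc_braid ts xt xs; have [b1 _] := asc_braid st xs xt.
have n01 : f x != f (x * sg s) by apply: gf.1 => //; rewrite wE.
have n12 : f (x * sg s) != f w by rewrite wE; apply: gf.1 => //; rewrite wE weak_refl.
have n23 : f w != j by rewrite eq_sym.
(* Otherwise the hexagon dictates the labels [j5] and [j4] of its far side; by induction they extend
   [f] from [x] to [x * sg t] and then to [x * sg t * sg s]. *)
have [j4 [j5 [n34 n45 n50 hx]]] := hex_solve (third s t) n01 n12 n23.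
have lx : len w = (len x).+2 by rewrite wE !len_asc.
have [||//|//|f1 [gf1 ag1 f1E]] := IHm x t f j5.
- by rewrite lx in lw; exact: ltnW.
- exact: good_weak gf.
have [||//||f2 [gf2 ag2 f2E]] := IHm (x * sg t) s f1 j4.
- by rewrite len_asc //; rewrite lx in lw.
- by [].
- by rewrite f1E.
(* The labellings [f] and [f2] are compatible: by [weak_meet] their intervals meet in [1, x]. *)
pose f' z := if weak z w then f z else if z == y then j else f2 z.
have F1 : agree w f' f by move=> z zw; rewrite /f' zw.
have F3 : f' y = j by rewrite /f' (negbTE nyw) eqxx.
have F2 : agree (y * sg t) f' f2.
  move=> z zt; rewrite /f'; have [zw|zw] := boolP (weak z w).
    have zx : weak z x.
      have := @weak_meet z y s t st ys yt; rewrite ysE {2}wE !sgK.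
      by apply.
    rewrite ag2 ?ag1 //; exact: weak_trans g1.
  case: eqP zt => // -> /weak_len; rewrite (len_dsc yt) ltnn //.
exists f'; split=> //; apply: good_glue => [u yu|u yu|x' u v uv xu xv yE'].
- have := dsc_at_most_two ys yt st yu; case/orP=> /eqP ->.
    by rewrite sgK; apply: good_agree gf; exact: agree_sym.
  by apply: good_agree (agree_sym F2) _; rewrite ytE.
- rewrite -/y F3.
  have := dsc_at_most_two ys yt st yu; case/orP=> /eqP ->.
    by rewrite ysE F1 ?weak_refl // eq_sym.
  by rewrite F2 ?weak_refl // ytE f2E eq_sym.
rewrite -/y in yE' *.
have yu : dsc y u by rewrite yE' dscM (asc_braid uv xu xv).2.
have yv : dsc y v.
  have vu : v != u by rewrite eq_sym.
  by rewrite yE' sgM_braid // dscM (asc_braid vu xv xu).2.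
have hxf : hex (third s t) (f' x) (f' (x * sg s)) (f' (x * sg s * sg t)) (f' y)
    (f' (x * sg t * sg s)) (f' (x * sg t)).
  rewrite F3 -wE (F1 w) ?weak_refl // (F1 x) // (F1 (x * sg s)) ?wE // -wE.
  rewrite (F2 (x * sg t * sg s)) ?ytE ?weak_refl // (F2 (x * sg t)) ?ytE //.
  by rewrite f2E (ag2 _ (weak_refl _)) f1E.
(* Since [y] has only the descents [s] and [t], a hexagon with top [y] is the one over [x], read in
   one of two directions. *)
have := dsc_at_most_two ys yt st yu; case/orP=> /eqP eu;
  have := dsc_at_most_two ys yt st yv; case/orP=> /eqP ev; subst u v;
  try by rewrite eqxx in uv.
  have -> : x' = x.
    by rewrite yE in yE'; apply: (mulIg (sg s));
      apply: (mulIg (sg t)); apply: (mulIg (sg s)).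
  exact: hxf.
have -> : x' = x.
  rewrite -(sgM_braid _ st) yE in yE'.
  by apply: (mulIg (sg s)); apply: (mulIg (sg t)); apply: (mulIg (sg s)).
by rewrite third_sym; apply: hex_rev.
Qed.

(** * The model chamber system, its panels and turns *)

Variable j0 : J.

(* A chamber of the model: labels on the weak order interval [1, tw], read as
   its convex hull with the base chamber. *)
Record tchamber := TChamber {
  tw : W;
  tf : W -> J;
  t_good : good tw tf;
  t_one : tf 1 = j0;
  t_out : forall z, ~~ weak z tw -> tf z = j0
}.

Definition lab (x : tchamber) : J := tf x (tw x).

(** The field [t_out] fixes the labels off the interval, so that agreement on the interval is
    equality. *)
Lemma tchamber_eq x y : tw x = tw y -> agree (tw x) (tf x) (tf y) -> x = y.
Proof.
case: x y => [w f g1 f1 fo] [w' f' g1' f1' fo'] /= ww'; subst w' => ff'.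
have {}ff' : f = f'.
  apply/funext => z; have [zw|zw] := boolP (weak z w); first exact: ff'.
  by rewrite fo // fo'.
by subst f'; congr TChamber; exact: Prop_irrelevance.
Qed.

Lemma tchamber_ex w f : good w f -> f 1 = j0 ->
  exists x, tw x = w /\ agree w (tf x) f.
Proof.
move=> gf f1; pose f' z := if weak z w then f z else j0.
have ag : agree w f' f by move=> z zw; rewrite /f' zw.
have out z : ~~ weak z w -> f' z = j0 by rewrite /f' => /negbTE ->.
have f'1 : f' 1 = j0 by rewrite ag ?weak1.
by exists (TChamber (good_agree (agree_sym ag) gf) f'1 out).
Qed.

(** The order hypothesis sits under the existential to make [restr] total; where it fails the value
    is arbitrary. *)
Lemma restr_ex x v : exists y,
  weak v (tw x) -> tw y = v /\ agree v (tf y) (tf x).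
Proof.
have [vx|nvx] := boolP (weak v (tw x)); last by exists x.
have [y yv] := tchamber_ex (good_weak vx (t_good x)) (t_one x).
by exists y.
Qed.

Definition restr x v : tchamber := projT1 (cid (restr_ex x v)).

Lemma tw_restr x v : weak v (tw x) -> tw (restr x v) = v.
Proof. by rewrite /restr; case: cid => y /= h /h[]. Qed.

Lemma tf_restr x v : weak v (tw x) -> agree v (tf (restr x v)) (tf x).
Proof. by rewrite /restr; case: cid => y /= h /h[]. Qed.

Lemma lab_restr x v : weak v (tw x) -> lab (restr x v) = tf x v.
Proof. by move=> vx; rewrite /lab tw_restr // tf_restr // weak_refl. Qed.

Lemma restr_eq x y v : weak v (tw x) -> weak v (tw y) ->
  agree v (tf x) (tf y) -> restr x v = restr y v.
Proof.
move=> vx vy xy; apply: tchamber_eq; rewrite !tw_restr // => z zv.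
by rewrite !tf_restr // xy.
Qed.

Lemma restr_id x : restr x (tw x) = x.
Proof.
apply: tchamber_eq; rewrite tw_restr ?weak_refl // => z zv.
by rewrite tf_restr ?weak_refl.
Qed.

Lemma restr_restr x v u : weak v (tw x) -> weak u v ->
  restr (restr x v) u = restr x u.
Proof.
move=> vx uv; apply: restr_eq; rewrite ?tw_restr //; first exact: weak_trans vx.
exact: agree_weak uv (tf_restr vx).
Qed.

(* The chamber of the s-panel of [x] closest to the base chamber. *)
Definition stem s x : tchamber :=
  if dsc (tw x) s then restr x (tw x * sg s) else x.

Lemma stem_asc s x : ~~ dsc (tw x) s -> stem s x = x.
Proof. by rewrite /stem => /negbTE ->. Qed.

Lemma tw_stem s x : tw (stem s x) = if dsc (tw x) s then tw x * sg s else tw x.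
Proof.
rewrite /stem; have [xs|//] := boolP (dsc (tw x) s).
by rewrite tw_restr // weak_dsc.
Qed.

Lemma dsc_stem s x : ~~ dsc (tw (stem s x)) s.
Proof.
by rewrite tw_stem; have [xs|//] := boolP (dsc (tw x) s); rewrite dscM xs.
Qed.

Lemma tf_stem s x : agree (tw (stem s x)) (tf (stem s x)) (tf x).
Proof.
rewrite /stem; have [xs|//] := boolP (dsc (tw x) s).
have := weak_dsc xs => h; rewrite tw_restr //; exact: tf_restr.
Qed.

(** With [panel_uniq], the chambers of a panel correspond to the labels: the stem carries one, and
    [good_extend] places each other label one step further out. *)
Lemma panel_ex s x k : exists y, stem s y = stem s x /\ lab y = k.
Proof.
set b := stem s x; have bs : ~~ dsc (tw b) s by exact: dsc_stem.
have [->|kb] := eqVneq k (lab b); first by exists b; rewrite stem_asc.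
have [f [gf fb fk]] := good_extend (t_good b) bs kb.
have [|y [yw yf]] := tchamber_ex gf; first by rewrite fb ?weak1 // t_one.
exists y; split; last by rewrite /lab yw yf ?weak_refl.
have ys : dsc (tw y) s by rewrite yw dscM.
apply: tchamber_eq; first by rewrite tw_stem ys yw sgK.
rewrite tw_stem ys yw sgK => z zb.
have zy : weak z (tw b * sg s) by apply: weak_trans zb (weak_asc bs).
rewrite (@tf_stem s y) ?tw_stem ?ys ?yw ?sgK // yf // fb //.
Qed.

Lemma panel_uniq s x y : stem s x = stem s y -> lab x = lab y -> x = y.
Proof.
have key u v : dsc (tw u) s -> ~~ dsc (tw v) s -> stem s u = stem s v ->
    lab u != lab v.
  move=> us vs uv; have us' : ~~ dsc (tw u * sg s) s by rewrite dscM us.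
  rewrite -(stem_asc vs) -uv /stem us lab_restr ?weak_dsc // eq_sym.
  by have := (t_good u).1 _ _ us'; rewrite sgK; apply; exact: weak_refl.
move=> xy lxy.
have [xs|xs] := boolP (dsc (tw x) s); have [ys|ys] := boolP (dsc (tw y) s).
- have wxy : tw x = tw y.
    by have := congr1 tw xy; rewrite !tw_stem xs ys => /mulIg.
  apply: tchamber_eq => //.
  apply: (good_uniq (t_good x) _ xs); rewrite ?wxy; first exact: t_good.
    have e : tw (stem s x) = tw y * sg s by rewrite tw_stem xs wxy.
    rewrite -e => z zx; rewrite -(tf_stem zx) xy (@tf_stem s y) // -xy //.
  by move: lxy; rewrite /lab wxy.
- by have := key _ _ xs ys xy; rewrite lxy eqxx.
- by have := key _ _ ys xs (esym xy); rewrite lxy eqxx.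
- by move: xy; rewrite !stem_asc.
Qed.

Definition turn s k x : tchamber := projT1 (cid (panel_ex s x k)).

Lemma stem_turn s k x : stem s (turn s k x) = stem s x.
Proof. by rewrite /turn; case: cid => y /= []. Qed.

Lemma lab_turn s k x : lab (turn s k x) = k.
Proof. by rewrite /turn; case: cid => y /= []. Qed.

Lemma turn_eq s x y : stem s x = stem s y -> turn s (lab x) y = x.
Proof. by move=> xy; apply: (@panel_uniq s); rewrite ?stem_turn ?lab_turn. Qed.

Lemma turn_turn s k l x : turn s k (turn s l x) = turn s k x.
Proof. by apply: (@panel_uniq s); rewrite ?stem_turn ?lab_turn. Qed.

Lemma turn_lab s x : turn s (lab x) x = x.
Proof. exact: turn_eq. Qed.

Lemma turn_same s k x : lab x = k -> turn s k x = x.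
Proof. by move=> <-; exact: turn_lab. Qed.

Lemma turn_restr x v s : ~~ dsc v s -> weak (v * sg s) (tw x) ->
  turn s (tf x (v * sg s)) (restr x v) = restr x (v * sg s).
Proof.
move=> vs vx; rewrite -lab_restr //; apply: turn_eq.
have vx' := weak_trans (weak_asc vs) vx.
rewrite [RHS]stem_asc ?tw_restr // /stem tw_restr // dscM vs sgK.
by rewrite restr_restr // weak_asc.
Qed.

Lemma tw_turn s k x : ~~ dsc (tw x) s -> k != lab x ->
  tw (turn s k x) = tw x * sg s.
Proof.
move=> xs kx; have := congr1 tw (stem_turn s k x).
rewrite (stem_asc xs) tw_stem; case: ifP => [_ <-|h _]; first by rewrite sgK.
have := stem_turn s k x; rewrite (stem_asc xs) stem_asc ?h // => tx.
by rewrite -tx lab_turn eqxx in kx.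
Qed.

Lemma restr_turn s k x : ~~ dsc (tw x) s -> k != lab x ->
  restr (turn s k x) (tw x) = x.
Proof.
move=> xs kx; have := stem_turn s k x; rewrite (stem_asc xs) /stem.
by rewrite tw_turn // dscM xs sgK.
Qed.

(** The chamber reached on the left labels the whole hexagon over [tw x]. By [hex_uniq] its
    remaining labels are [j4] and [j5], so its restrictions along the far side are the turns on the
    right. *)
Lemma turn_hexagon s t x j1 j2 j3 j4 j5 : s != t ->
  ~~ dsc (tw x) s -> ~~ dsc (tw x) t ->
  j1 != lab x -> j2 != j1 -> j3 != j2 -> j4 != j5 ->
  hex (third s t) (lab x) j1 j2 j3 j4 j5 ->
  turn s j3 (turn t j2 (turn s j1 x)) = turn t j3 (turn s j4 (turn t j5 x)).
Proof.
move=> st xs xt n1 n2 n3 n45 h; have ts : t != s by rewrite eq_sym.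
have [a1 a2] := asc_braid st xs xt; have [b1 b2] := asc_braid ts xt xs.
have [h1 h2 h3] := hexagon_weak st xs xt; have [g1 g2 g3] := hexagon_weak ts xt xs.
set x1 := turn s j1 x; set x2 := turn t j2 x1; set x3 := turn s j3 x2.
have w1 : tw x1 = tw x * sg s by exact: tw_turn.
have w2 : tw x2 = tw x * sg s * sg t by rewrite -w1 tw_turn ?w1 ?lab_turn.
have w3 : tw x3 = tw x * sg s * sg t * sg s by rewrite -w2 tw_turn ?w2 ?lab_turn.
have r2 : restr x3 (tw x2) = x2 by apply: restr_turn; rewrite ?w2 ?lab_turn.
have r1 : restr x3 (tw x1) = x1.
  rewrite -{2}(restr_turn (s:=t) (k:=j2) (x:=x1)) ?w1 ?lab_turn // -/x2 -r2.
  by rewrite restr_restr // ?w3 w2.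
have r0 : restr x3 (tw x) = x.
  rewrite -{2}(restr_turn (s:=s) (k:=j1) (x:=x)) // -/x1 -r1.
  by rewrite restr_restr // ?w3 w1 //; exact: weak_trans h3.
have f0 : tf x3 (tw x) = lab x.
  rewrite -{2}r0 lab_restr // w3; exact: weak_trans (weak_trans h2 h3).
have f1 : tf x3 (tw x * sg s) = j1.
  by rewrite -w1 -lab_restr ?r1 ?lab_turn // w1 w3; exact: weak_trans h3.
have f2 : tf x3 (tw x * sg s * sg t) = j2.
  by rewrite -w2 -lab_restr ?r2 ?lab_turn // w2 w3.
have f3 : tf x3 (tw x * sg s * sg t * sg s) = j3.
  by rewrite -w3; exact: lab_turn.
have g3' : weak (tw x * sg t * sg s) (tw x3) by rewrite w3 (sgM_braid _ st).
have g2' : weak (tw x * sg t) (tw x3) by exact: weak_trans g3'.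
have := (t_good x3).2 _ _ _ st xs xt; rewrite {1}w3 weak_refl => /(_ isT).
rewrite f0 f1 f2 f3 => h'.
have [e4 e5] := hex_uniq n45 h h'.
have R1 := turn_restr xt g2'; rewrite -e5 r0 in R1.
have R2 := turn_restr b1 g3'; rewrite -e4 -R1 in R2.
have := turn_restr b2; rewrite -(sgM_braid _ st) => /(_ x3).
by rewrite {1}w3 weak_refl f3 -R2 -w3 restr_id => /(_ isT).
Qed.

(** * Rank 2 residues *)

Section Residue.
Variables (b c : 'I_3) (bc : b != c).
Local Notation d := (delta (third b c)).

(** A nonzero difference determines its two terms; for the zero difference the middle turn does
    nothing. *)
Lemma turn_diff x k j1 j2 l1 l2 : (d j1 - d j2 = d l1 - d l2)%R ->
  turn b k (turn c j2 (turn b j1 x)) = turn b k (turn c l2 (turn b l1 x)).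
Proof.
move=> e; have deg j : turn b k (turn c j (turn b j x)) = turn b k x.
  by rewrite (@turn_same c j (turn b j x)) ?lab_turn // turn_turn.
have [e12|n12] := eqVneq j1 j2.
  have l12 : l1 = l2 by apply: (@diff_eq0 (third b c)); rewrite -e e12 subrr.
  by rewrite e12 l12 !deg.
by have [-> ->] := diff_inj e n12.
Qed.

(** A coincidence of neighbouring labels makes one turn trivial and leaves a case of [turn_diff].
    Otherwise a hexagon trades the path of type c, b, c for one of type b, c, b. *)
Lemma turn_residue_base x k j2 j3 l1 l2 : ~~ dsc (tw x) c -> ~~ dsc (tw x) b ->
  (d (lab x) - d j2 + d j3 - d k = d l1 - d l2)%R ->
  turn c k (turn b j3 (turn c j2 x)) = turn b k (turn c l2 (turn b l1 x)).
Proof.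
move=> xc xb e; have cb : c != b by rewrite eq_sym.
have [j23|n32] := eqVneq j3 j2.
  rewrite j23 (@turn_same b j2 (turn c j2 x)) ?lab_turn // turn_turn.
  rewrite -(@turn_diff x k (lab x) k) // ?turn_lab; last first.
    by apply: (eq_lin e); rewrite j23; ring.
  by rewrite [RHS]turn_same ?lab_turn.
have [j20|n20] := eqVneq j2 (lab x).
  rewrite j20 turn_lab -(@turn_diff x k j3 k) //; last first.
    by apply: (eq_lin e); rewrite j20; ring.
  by rewrite [RHS]turn_same ?lab_turn.
have [k3|nk3] := eqVneq k j3.
  rewrite k3 (@turn_same c j3 (turn b j3 (turn c j2 x))) ?lab_turn //.
  rewrite -(@turn_diff x j3 (lab x) j2) // ?turn_lab //.
  by apply: (eq_lin e); rewrite k3; ring.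
have [m4 [m5 [_ n45 _ h]]] : exists m4 m5, [/\ k != m4, m4 != m5, m5 != lab x &
    hex (third c b) (lab x) j2 j3 k m4 m5].
  by apply: hex_solve; rewrite eq_sym.
rewrite (turn_hexagon cb _ _ _ _ _ n45 h) //; apply: turn_diff => //.
by rewrite third_sym in h;
  apply: (eq_lin (etrans (f_equal2 +%R e h) (addrC _ _))); ring.
Qed.

(* The rank 2 residues are projective planes: three consecutive turns move
   along a flag by the sum of the differences, whichever way they go. *)
Lemma turn_residue x k j1 j2 j3 l1 l2 : ~~ dsc (tw x) c -> ~~ dsc (tw x) b ->
  (d j1 - d j2 + d j3 - d k = d l1 - d l2)%R ->
  turn c k (turn b j3 (turn c j2 (turn b j1 x))) =
  turn b k (turn c l2 (turn b l1 x)).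
Proof.
move=> xc xb e.
have [j10|n10] := eqVneq j1 (lab x).
  by rewrite j10 turn_lab; apply: turn_residue_base; rewrite -?j10.
have [j21|n21] := eqVneq j2 j1.
  rewrite j21 (@turn_same c j1 (turn b j1 x)) ?lab_turn // turn_turn.
  rewrite -(@turn_diff x k j3 k) //; last by apply: (eq_lin e); rewrite j21; ring.
  by rewrite [RHS]turn_same ?lab_turn.
have [j32|n32] := eqVneq j3 j2.
  rewrite j32 (@turn_same b j2 (turn c j2 (turn b j1 x))) ?lab_turn // turn_turn.
  rewrite -(@turn_diff x k j1 k) //; last by apply: (eq_lin e); rewrite j32; ring.
  by rewrite [RHS]turn_same ?lab_turn.
have [m4 [m5 [_ n45 _ h]]] : exists m4 m5, [/\ j3 != m4, m4 != m5, m5 != lab x &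
    hex (third b c) (lab x) j1 j2 j3 m4 m5].
  by apply: hex_solve; rewrite eq_sym.
rewrite (turn_hexagon bc xb xc n10 n21 n32 n45 h) turn_turn.
apply: turn_residue_base => //.
by apply: (eq_lin (etrans (f_equal2 +%R e (esym h)) (addrC _ _))); ring.
Qed.

(** Stems lead down to the chamber [y] of the residue closest to the base chamber; on the way back a
    step across a c-panel is absorbed by [turn_residue]. *)
Lemma residue_rep x : exists y l1 l2, [/\ ~~ dsc (tw y) c, ~~ dsc (tw y) b &
  x = turn b (lab x) (turn c l2 (turn b l1 y))].
Proof.
have [m] := ubnP (len (tw x)); elim: m x => // m IHm x xm.
have shorter s : dsc (tw x) s -> (len (tw (stem s x)) < m)%N.
  by move=> xs; rewrite tw_stem xs -ltnS -(len_dsc xs).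
have stem_stem s : stem s (stem s x) = stem s x by rewrite stem_asc ?dsc_stem.
have xE s : x = turn s (lab x) (stem s x) by rewrite turn_eq.
have [xb|xb] := boolP (dsc (tw x) b).
  have [y [l1 [l2 [yc yb E]]]] := IHm _ (shorter _ xb).
  exists y, l1, l2; split=> //.
  by rewrite {1}(xE b) {1}E turn_turn.
have [xc|xc] := boolP (dsc (tw x) c); last first.
  exists x, (lab x), (lab x); split=> //.
  by rewrite turn_lab turn_lab turn_lab.
have [y [l1 [l2 [yc yb E]]]] := IHm _ (shorter _ xc).
have [[m1 m2] /= e] := diff_surj (third b c)
  (d l1 - d l2 + d (lab (stem c x)) - d (lab x))%R.
exists y, m1, m2; split=> //.
by rewrite {1}(xE c) {1}E; exact: turn_residue.
Qed.

End Residue.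

(** * Rotations about vertices *)

Definition dif a v : J * J := projT1 (cid (diff_surj a v)).

Lemma difE a v : (delta a (dif a v).1 - delta a (dif a v).2 = v)%R.
Proof. by rewrite /dif; case: cid. Qed.

Lemma third_next a : third (a + 1)%R (a + 2%:R)%R = a.
Proof. by elim/ord3P: a; apply/val_inj. Qed.

Lemma next_neq (a : 'I_3) : (a + 1 != a + 2%:R)%R.
Proof. by elim/ord3P: a. Qed.

(* Rotation by [v] about the vertex of type [a], fixing labels. *)
Definition vrot a v x : tchamber :=
  turn (a + 1)%R (lab x) (turn (a + 2%:R)%R (dif a v).2
    (turn (a + 1)%R (dif a v).1 x)).

Lemma lab_vrot a v x : lab (vrot a v x) = lab x.
Proof. exact: lab_turn. Qed.

(** In the coordinates of [residue_rep], a chamber is a difference together with a label, and the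
    rotation adds [v] to the difference. *)
Lemma vrot_residue a v y k l1 l2 :
  ~~ dsc (tw y) (a + 2%:R)%R -> ~~ dsc (tw y) (a + 1)%R ->
  exists m1 m2, (delta a m1 - delta a m2 = delta a l1 - delta a l2 + v)%R /\
  forall j1 j2, (delta a j1 - delta a j2 = v)%R ->
  turn (a + 1)%R k (turn (a + 2%:R)%R j2 (turn (a + 1)%R j1
    (turn (a + 1)%R k (turn (a + 2%:R)%R l2 (turn (a + 1)%R l1 y))))) =
  turn (a + 1)%R k (turn (a + 2%:R)%R m2 (turn (a + 1)%R m1 y)).
Proof.
move=> yc yb.
have [[m1 m2] /= e] := diff_surj a (delta a l1 - delta a l2 + v)%R.
exists m1, m2; split=> // j1 j2 j12.
rewrite turn_turn (turn_residue (next_neq a) (l1 := m1) (l2 := m2)) //.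
  by rewrite turn_turn.
by rewrite third_next e -j12; ring.
Qed.

Lemma vrotE a v x j1 j2 : (delta a j1 - delta a j2 = v)%R ->
  vrot a v x = turn (a + 1)%R (lab x) (turn (a + 2%:R)%R j2 (turn (a + 1)%R j1 x)).
Proof.
move=> j12; have [y [l1 [l2 [yc yb xE]]]] := residue_rep (next_neq a) x.
have [m1 [m2 [e h]]] := vrot_residue v (lab x) l1 l2 yc yb.
by rewrite /vrot [in LHS]xE [in RHS]xE !lab_turn !h // difE.
Qed.

Lemma vrot0 a x : vrot a 0 x = x.
Proof. by rewrite (@vrotE _ _ _ (lab x) (lab x)) ?subrr // !turn_lab. Qed.

Lemma vrotD a u v x : vrot a v (vrot a u x) = vrot a (u + v)%R x.
Proof.
have [y [l1 [l2 [yc yb xE]]]] := residue_rep (next_neq a) x.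
have [m1 [m2 [e h]]] := vrot_residue u (lab x) l1 l2 yc yb.
have [n1 [n2 [e' h']]] := vrot_residue v (lab x) m1 m2 yc yb.
have [p1 [p2 [e'' h'']]] := vrot_residue (u + v)%R (lab x) l1 l2 yc yb.
have ru : vrot a u x =
    turn (a + 1)%R (lab x) (turn (a + 2%:R)%R m2 (turn (a + 1)%R m1 y)).
  by rewrite /vrot [in LHS]xE !lab_turn h // difE.
rewrite {1}/vrot lab_vrot ru h' ?difE // /vrot [in RHS]xE !lab_turn h'' ?difE //.
by apply: turn_diff => //; rewrite third_next e' e e''; ring.
Qed.

(** Passing from one panel at a vertex to the other costs a rotation; [pan_step] is the counterpart
    in the group. *)
Lemma turn_vrot a x k : turn (a + 2%:R)%R k x =
  vrot a (delta a (lab x) - delta a k)%R (turn (a + 1)%R k x).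
Proof.
rewrite (@vrotE _ _ _ (lab x) k) // lab_turn turn_turn turn_lab.
by rewrite [RHS]turn_same ?lab_turn.
Qed.

End DifferenceFamily.

(** * The building *)

Section Lattice.
Variables (q : nat) (delta : 'I_3 -> 'I_q.+1 -> 'Z_(singer_order q)).
Hypothesis q_gt1 : (1 < q)%N.
Hypothesis delta_diff : forall a, perfect_difference (delta a).
Hypothesis delta0 : forall a, delta a ord0 = 0%R.

Local Notation n := (singer_order q).
Local Notation J := 'I_q.+1.
Local Notation G := (Gamma2 delta).

Lemma singer_order_gt1 : (1 < n)%N.
Proof. by rewrite /singer_order; lia. Qed.

Definition gen (a : 'I_3) : G := pres_gen _ a.

Definition pw (a : 'I_3) (v : 'Z_n) : G := gen a ^+ (v : nat).

Lemma gen_order a : gen a ^+ n = 1.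
Proof.
rewrite -word_class_nseq; apply: word_class_rel.
by left; exists a.
Qed.

Lemma pw_nat a k : pw a (k%:R)%R = gen a ^+ k.
Proof.
rewrite /pw val_Zp_nat ?singer_order_gt1 // {2}(divn_eq k n) expgnDr mulnC expgnA.
by rewrite gen_order expg1n mul1g.
Qed.

Lemma pwD a u v : pw a (u + v)%R = pw a u * pw a v.
Proof. by rewrite -[u in LHS]natr_Zp -[v in LHS]natr_Zp -natrD pw_nat expgnDr. Qed.

Lemma pw0 a : pw a 0%R = 1.
Proof. by rewrite /pw expg0. Qed.

Lemma pwN a v : pw a (- v)%R = (pw a v)^-1.
Proof. by apply/(mulIg (pw a v)); rewrite -pwD addNr pw0 mulVg. Qed.

Lemma pw1 a : pw a 1%R = gen a.
Proof. by have := pw_nat a 1; rewrite expg1. Qed.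

Lemma Gamma2_rel j :
  pw 0%R (delta 0%R j) * pw 1%R (delta 1%R j) * pw 2%:R%R (delta 2%:R%R j) = 1.
Proof.
have : word_class (Gamma2_relators delta) (gen_pow 0%R (delta 0%R j) ++
    gen_pow 1%R (delta 1%R j) ++ gen_pow 2%:R%R (delta 2%:R%R j)) = 1.
  by apply: word_class_rel; right; exists j.
by rewrite !word_class_cat !word_class_nseq mulgA.
Qed.

Lemma neq_next (s t : 'I_3) : s != t -> let a := third s t in
  (s = a + 1 /\ t = a + 2%:R)%R \/ (s = a + 2%:R /\ t = a + 1)%R.
Proof.
by elim/ord3P: s; elim/ord3P: t => // _ /=; rewrite !third_table;
  (by left; split; exact: val_inj) || (by right; split; exact: val_inj).
Qed.

(* The chambers are the pairs [(g, j)], and [g * pan s j] is the panel of type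
   [s] of [(g, j)]: the group acts simply transitively on the panels of each
   type. *)
Definition pan (s : 'I_3) (j : J) : G :=
  if s == 1%R then 1
  else if s == 2%:R%R then pw 0%R (delta 0%R j)
  else pw 0%R (delta 0%R j) * pw 1%R (delta 1%R j).

Lemma pan_step a j : pan (a + 2%:R)%R j = pan (a + 1)%R j * pw a (delta a j).
Proof.
elim/ord3P: a; rewrite /pan /= ?mul1g //.
by rewrite Gamma2_rel.
Qed.

Lemma pan0 s : pan s ord0 = 1.
Proof. by rewrite /pan !delta0 !pw0 mulg1; case: ifP => //; case: ifP. Qed.

(** The sign [eps] records in which order [s] and [t] follow the type of the vertex. *)
Lemma pan_next (s t : 'I_3) : s != t -> exists eps : 'Z_n, forall j,
  pan t j = pan s j * pw (third s t) (eps * delta (third s t) j)%R.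
Proof.
move=> /neq_next[] []; move: (third s t) => a -> ->.
  by exists 1%R => j; rewrite mul1r pan_step.
by exists (- 1)%R => j; rewrite pan_step mulN1r pwN mulgK.
Qed.

Definition cham : Type := (G * J)%type.
HB.instance Definition _ := Choice.on cham.

Definition panel (s : 'I_3) (D : cham) : G := D.1 * pan s D.2.

Definition cham_of (s : 'I_3) (h : G) (j : J) : cham := (h * (pan s j)^-1, j).

Lemma panel_of s h j : panel s (cham_of s h j) = h.
Proof. by rewrite /panel /= mulgVK. Qed.

Lemma cham_of_panel s D : cham_of s (panel s D) D.2 = D.
Proof. by case: D => g j; rewrite /cham_of /panel /= mulgK. Qed.

Lemma panel_inj s D E : panel s D = panel s E -> D.2 = E.2 -> D = E.
Proof. by move=> h l; rewrite -(cham_of_panel s D) h l cham_of_panel. Qed.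

Definition adj s (D E : cham) : Prop := panel s D = panel s E /\ D <> E.

Lemma adj_lab s D E : adj s D E -> D.2 != E.2.
Proof. by move=> [h DE]; apply/eqP => l; apply: DE; exact: panel_inj h l. Qed.

Lemma adj_panel s D E F : adj s D E -> adj s E F -> D = F \/ adj s D F.
Proof.
move=> [DE _] [EF _]; have [->|DF] := pselect (D = F); first by left.
by right; split => //; rewrite DE.
Qed.

(** Around a vertex, panels differ by powers of one generator, so the path closes up as soon as the
    exponents satisfy [hex]. *)
Lemma adj_braid s t D0 D1 D2 D3 : s != t ->
  adj s D0 D1 -> adj t D1 D2 -> adj s D2 D3 ->
  exists E1 E2, [/\ adj t D0 E1, adj s E1 E2 & adj t E2 D3].
Proof.
move=> st a01 a12 a23.
have [j4 [j5 [n34 n45 n50 h]]] :=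
  hex_solve delta_diff (third s t) (adj_lab a01) (adj_lab a12) (adj_lab a23).
have [eps pE] := pan_next st.
have pt D : panel t D =
    panel s D * pw (third s t) (eps * delta (third s t) D.2)%R.
  by rewrite /panel pE mulgA.
have ps D : panel s D =
    panel t D * pw (third s t) (- (eps * delta (third s t) D.2))%R.
  by rewrite pt pwN mulgK.
pose E1 := cham_of t (panel t D0) j5; pose E2 := cham_of s (panel s E1) j4.
have p1 : panel t E1 = panel t D0 by exact: panel_of.
have p2 : panel s E2 = panel s E1 by exact: panel_of.
exists E1, E2; split; split => //.
- by move=> /(congr1 snd) /= e; rewrite e eqxx in n50.
- by move=> /(congr1 snd) /= e; rewrite e eqxx in n45.
- rewrite pt p2 ps p1 (pt D3) -a23.1 (ps D2) -a12.1 (pt D1) -a01.1 (pt D0).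
  rewrite -!mulgA -!pwD; congr (_ * (_ * pw _ _)).
  rewrite /hex in h; move/(congr1 (fun v => eps * v)%R): h => h.
  by apply: (eq_lin (esym h)) => /=; ring.
- by move=> /(congr1 snd) /= e; rewrite e eqxx in n34.
Qed.

(** * The developing map to the model *)

Section Retraction.
Variable j0 : J.
Local Notation X := (tchamber delta j0).
Local Notation vrot := (@vrot _ _ _ delta_diff j0).
Local Notation turn := (@turn _ _ _ delta_diff j0).
Local Notation lab := (@lab _ _ delta j0).
Local Notation stem := (@stem _ _ delta j0).

Definition letter (l : 'I_3 * bool) (x : X) : X :=
  vrot l.1 (if l.2 then - 1 else 1)%R x.

Definition act (u : word 'I_3) (x : X) : X := foldl (fun x l => letter l x) x u.

Lemma lab_act u x : lab (act u x) = lab x.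
Proof. by elim: u x => //= l u IHu x; rewrite IHu lab_vrot. Qed.

Lemma act_gen_pow a k x : act (gen_pow a k) x = vrot a (k%:R)%R x.
Proof.
elim: k x => [|k IHk] x /=; first by rewrite vrot0.
by rewrite IHk /letter vrotD mulrS.
Qed.

Lemma vrot_turn a u : turn (a + 2%:R)%R ord0 u =
  vrot a (delta a (lab u)) (turn (a + 1)%R ord0 u).
Proof. by rewrite turn_vrot delta0 subr0. Qed.

Lemma act_pres u v : pres_eq (Gamma2_relators delta) u v ->
  forall x, lab x = ord0 -> act u x = act v x.
Proof.
elim=> {u v} //.
- by move=> u v _ IH x x0; rewrite IH.
- by move=> u v w _ IH _ IH' x x0; rewrite IH ?IH'.
- move=> a b u v _ IH x x0; rewrite /act !foldl_cat -!/(act _ _) IH //.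
  by rewrite lab_act.
- move=> a b x _; rewrite /act /= /letter /= vrotD.
  by case: b; rewrite /= ?addNr ?subrr vrot0.
move=> r [[a ->] x _|[j ->] x x0].
  by rewrite act_gen_pow pchar_Zp ?vrot0 // singer_order_gt1.
rewrite /act !foldl_cat -!/(act _ _) !act_gen_pow !natr_Zp.
(* The relation of index [j] is a tour of the three panels of [u], of types 1, 2, 0 and back to 1:
   each rotation carries the chamber of label 0 in one panel to that of the next. *)
pose u := turn 1%R j x; have lu : lab u = j by exact: lab_turn.
have xE : turn 1%R ord0 u = x by rewrite turn_turn turn_same.
have o (s t : 'I_3) : nat_of_ord s = nat_of_ord t -> s = t by exact: val_inj.
have := vrot_turn 0%R u; have := vrot_turn 1%R u; have := vrot_turn 2%:R%R u.
rewrite lu (o (0 + 1)%R 1%R) // (o (0 + 2%:R)%R 2%:R%R) //.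
rewrite (o (1 + 1)%R 2%:R%R) // (o (1 + 2%:R)%R 0%R) //.
rewrite (o (2%:R + 1)%R 0%R) // (o (2%:R + 2%:R)%R 1%R) //.
by rewrite xE => h2 h1 h0; rewrite -h0 -h1 -h2.
Qed.

Lemma good_base : good delta 1 (fun=> j0).
Proof.
split=> [x s xs|x s t st xs xt].
  by move=> /weak_len; rewrite len_asc // len1.
by move=> /weak_len; rewrite sgM_braid // len_asc ?len1 //;
  have [] := asc_braid (_ : t != s) xt xs; rewrite // eq_sym.
Qed.

Definition base : X := projT1 (cid (tchamber_ex good_base (erefl j0))).

Lemma tw_base : tw base = 1.
Proof. by rewrite /base; case: cid => x []. Qed.

Lemma lab_base : lab base = j0.
Proof. by rewrite /lab tw_base t_one. Qed.

Definition gact (g : G) : X := act (repr g) (turn 1%R ord0 base).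

Lemma gact_class u : gact (word_class _ u) = act u (turn 1%R ord0 base).
Proof.
apply: act_pres; last by rewrite lab_turn.
by apply/word_classP; rewrite word_class_repr.
Qed.

Lemma lab_gact g : lab (gact g) = ord0.
Proof. by rewrite lab_act lab_turn. Qed.

Lemma gact1 : gact 1 = turn 1%R ord0 base.
Proof. exact: (gact_class [::]). Qed.

Lemma gactM g a v : gact (g * pw a v) = vrot a v (gact g).
Proof.
rewrite -[g]word_class_repr -[v in RHS]natr_Zp -act_gen_pow.
rewrite /pw -word_class_nseq -word_class_cat !gact_class.
by rewrite /act foldl_cat.
Qed.

(** The developing map. It passes through the panel of type 1, where [pan] is trivial. *)
Definition dev (D : cham) : X := turn 1%R D.2 (gact D.1).

Lemma lab_dev D : lab (dev D) = D.2.
Proof. exact: lab_turn. Qed.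

Lemma dev_base : dev (1, j0) = base.
Proof. by rewrite /dev gact1 turn_turn turn_same // lab_base. Qed.

(** [vrot_turn] and [pan_step] change the panel type in parallel, which carries the claim from type
    1 to type 2 and then to type 0. *)
Lemma turn_dev s D : turn s ord0 (dev D) = gact (panel s D).
Proof.
have h1 : turn 1%R ord0 (dev D) = gact (panel 1%R D).
  by rewrite turn_turn turn_same ?lab_gact // /panel mulg1.
have step a : turn (a + 1)%R ord0 (dev D) = gact (panel (a + 1)%R D) ->
    turn (a + 2%:R)%R ord0 (dev D) = gact (panel (a + 2%:R)%R D).
  by move=> h; rewrite vrot_turn h -gactM lab_dev /panel pan_step mulgA.
have h2 : turn 2%:R%R ord0 (dev D) = gact (panel 2%:R%R D).
  have := step 0%R; rewrite (_ : 0 + 1 = 1)%R; last exact: val_inj.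
  by rewrite (_ : 0 + 2%:R = 2%:R)%R; [exact|exact: val_inj].
elim/ord3P: s => //; have := step 1%R.
rewrite (_ : 1 + 1 = 2%:R)%R; last exact: val_inj.
by rewrite (_ : 1 + 2%:R = 0)%R; [exact|exact: val_inj].
Qed.

Lemma stem_dev s D E : panel s D = panel s E -> stem s (dev D) = stem s (dev E).
Proof.
move=> DE; have := congr1 (stem s) (turn_dev s D).
by rewrite DE -turn_dev !stem_turn.
Qed.

Lemma dev_panel s D E : adj s D E -> ~~ dsc (tw (dev D)) s ->
  tw (dev E) = tw (dev D) * sg s.
Proof.
move=> DE Ds; have ED : dev E = turn s E.2 (dev D).
  by rewrite -lab_dev turn_eq // (stem_dev DE.1).
rewrite ED tw_turn // lab_dev eq_sym; exact: adj_lab DE.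
Qed.

Lemma dev_stem s D : exists2 E, panel s E = panel s D & dev E = stem s (dev D).
Proof.
pose k := lab (stem s (dev D)); exists (cham_of s (panel s D) k).
  exact: panel_of.
have h := @stem_dev s (cham_of s (panel s D) k) D (panel_of _ _ _).
apply: (panel_uniq delta_diff (s := s)); first by rewrite h [RHS]stem_asc ?dsc_stem.
exact: lab_dev.
Qed.

(** Connectedness of the chamber system of the group. *)
Lemma panel_closed (P : cham -> Prop) :
  (forall s D E, panel s D = panel s E -> P D -> P E) -> P (1, j0) -> forall D, P D.
Proof.
move=> clos Pb.
have P0 : P (1, ord0).
  exact: (clos 1%R) Pb.
have PM g a v : P (g, ord0) -> P (g * pw a v, ord0).
  (* Crossing panels of types a + 1, a + 2, a + 1 with labels [j], [k], 0 multiplies by the power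
     with exponent delta a j - delta a k. *)
  move=> Pg; have [[j k] /= jk] := diff_surj delta_diff a v.
  pose D1 := cham_of (a + 1)%R g j.
  have P1 : P D1.
    by apply: (clos (a + 1)%R) Pg; rewrite panel_of /panel /= pan0 mulg1.
  pose D2 := cham_of (a + 2%:R)%R (g * pw a (delta a j)) k.
  have P2 : P D2.
    by apply: (clos (a + 2%:R)%R) P1; rewrite panel_of /panel pan_step mulgA mulgVK.
  apply: (clos (a + 1)%R D2) => //; rewrite /panel /= pan0 mulg1 pan_step.
  by rewrite invgM !mulgA mulgVK -pwN -mulgA -pwD jk.
have Pg g : P (g, ord0).
  elim/presented_group_ind: g => [//|g a|g a].
    by rewrite -/(gen a) -pw1; exact: PM.
  by rewrite -/(gen a) -pw1 -pwN; exact: PM.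
by move=> [g j]; exact: (clos 1%R) (Pg g).
Qed.

Lemma reach_tw w D : reach adj (1, j0) w D -> tw (dev D) = w.
Proof.
elim=> [|v s E F _ vE nvs EF]; first by rewrite dev_base tw_base.
by rewrite (dev_panel EF) vE.
Qed.

Lemma reachable D : exists w, reach adj (1, j0) w D.
Proof.
move: D; apply: panel_closed => [s D E DE [w wD]|]; last by exists 1; exact: reach1.
have [<-|nDE] := pselect (D = E); first by exists w.
exact: (reach_adj adj_braid adj_panel wD (conj DE nDE)).
Qed.

(** Some gallery of reduced type w leads to [D] and develops to a chamber with [tw] equal to w; for
    w = 1 it has no steps. *)
Lemma tw_dev_eq1 D : tw (dev D) = 1 <-> D = (1, j0).
Proof.
split=> [D1|->]; last by rewrite dev_base tw_base.
have [w wD] := reachable D; move: (reach_tw wD); rewrite D1 => w1.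
case: wD w1 => // v s E F _ nvs _ /(congr1 len); rewrite len1 len_asc //.
Qed.

End Retraction.

(** * Translations, Weyl distance and building axioms *)

Definition translate (g : G) (D : cham) : cham := (g * D.1, D.2).

Lemma translateM g h D : translate g (translate h D) = translate (g * h) D.
Proof. by rewrite /translate mulgA. Qed.

Lemma translate1 D : translate 1 D = D.
Proof. by case: D => g j; rewrite /translate /= mul1g. Qed.

Lemma panel_translate s g D : panel s (translate g D) = g * panel s D.
Proof. by rewrite /panel mulgA. Qed.

Lemma translate_inj g : injective (translate g).
Proof. by move=> D E /(congr1 (translate g^-1)); rewrite !translateM mulVg !translate1. Qed.

Lemma adj_translate s g D E : adj s D E -> adj s (translate g D) (translate g E).
Proof.
by move=> [DE nDE]; split=> [|/translate_inj//]; rewrite !panel_translate DE.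
Qed.

(* The Weyl distance from [c] to [D]. *)
Definition retr (c D : cham) : W := tw (dev c.2 (translate c.1^-1 D)).

Lemma retr_eq1 c D : retr c D = 1 <-> D = c.
Proof.
rewrite /retr; split=> [/tw_dev_eq1 h|->].
  rewrite -[D]translate1 -(mulgV c.1) -translateM h.
  by case: c {h} => g j; rewrite /translate /= mulg1.
by apply/tw_dev_eq1; rewrite /translate /= mulVg.
Qed.

Lemma retr_translate g c D : retr (translate g c) (translate g D) = retr c D.
Proof. by rewrite /retr translateM invgM mulgVK. Qed.

Lemma retr_asc c s D E : adj s D E -> ~~ dsc (retr c D) s ->
  retr c E = retr c D * sg s.
Proof. by move=> /(@adj_translate s c.1^-1); exact: dev_panel. Qed.

Lemma retr_dsc c s D : dsc (retr c D) s ->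
  exists2 E, adj s E D & retr c E = retr c D * sg s.
Proof.
move=> Ds; have [E pE dE] := dev_stem c.2 s (translate c.1^-1 D).
have rE : retr c (translate c.1 E) = retr c D * sg s.
  by rewrite /retr translateM mulVg translate1 dE tw_stem; move: Ds; rewrite /retr => ->.
exists (translate c.1 E) => //; split.
  by rewrite panel_translate pE panel_translate mulVKg.
by move=> ED; move: (dscM (retr c D) s); rewrite -rE ED Ds.
Qed.

Lemma retr_adj c s D E : adj s D E ->
  retr c E = retr c D * sg s \/ retr c E = retr c D.
Proof.
move=> DE; have [Ds|Ds] := boolP (dsc (retr c D) s); last first.
  by left; exact: retr_asc DE Ds.
have [F FD rF] := retr_dsc Ds.
have nFs : ~~ dsc (retr c F) s by rewrite rF dscM Ds.
have [FE|/retr_asc/(_ nFs) ->] := adj_panel FD DE; first by left; rewrite -rF FE.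
by right; rewrite rF sgK.
Qed.

Lemma adj_sym s D E : adj s D E -> adj s E D.
Proof. by move=> [h n]; split=> // e; apply: n. Qed.

Lemma retr_sg c s D : retr c D = sg s <-> adj s D c.
Proof.
have dsc1 : ~~ dsc 1 s by rewrite /dsc shi1.
split=> [rD|/adj_sym Dc].
  have Ds : dsc (retr c D) s by rewrite rD -[sg s]mul1g dscM dsc1.
  have [F FD] := retr_dsc Ds; rewrite rD sg_sq => /retr_eq1 <-.
  exact: adj_sym.
have rc : retr c c = 1 by apply/retr_eq1.
by rewrite (retr_asc Dc) rc ?mul1g.
Qed.

Lemma lenV w : len w^-1 = len w.
Proof.
suff h v : (len v^-1 <= len v)%N.
  by apply/eqP; rewrite eqn_leq h /= -{1}[w]invgK h.
have [e <- ->] := reduced_word v; elim: e => [|s e IHe].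
  by rewrite big_nil invg1 len1.
rewrite big_cons invgM sgV /=.
set u := (\prod_(i <- e) sg i)^-1 in IHe *.
have [/len_dsc us|/len_asc ->] := boolP (dsc u s); last by [].
by apply: leq_trans (ltnW _) (leqW IHe); rewrite [X in (_ < X)%N]us.
Qed.

(* The retraction is centered at the second argument because the axioms move the
   first one inside a panel. *)
Definition cdist (C D : cham) : W := (retr D C)^-1.

Lemma cdist_sg s C D : cdist C D = sg s <-> adj s C D.
Proof.
rewrite -retr_sg /cdist -{1}(sgV s).
by split=> [/invg_inj|->].
Qed.

Lemma cdist_inhabited : inhabited cham.
Proof. exact: (inhabits (1, ord0)). Qed.

Lemma cdist_eq1 C D : cdist C D = 1 <-> C = D.
Proof.
rewrite -retr_eq1 /cdist -{1}(@invg1 W).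
by split=> [/invg_inj|->].
Qed.

Lemma cdist_adj s C C' D : cdist C' C = sg s ->
  cdist C' D = sg s * cdist C D \/ cdist C' D = cdist C D.
Proof.
move=> /cdist_sg/adj_sym CC'; rewrite /cdist.
have [->|->] := retr_adj D CC'; last by right.
by left; rewrite invgM sgV.
Qed.

Lemma cdist_adj_reduced s C C' D m : cdist C' C = sg s ->
  has_length (cdist C D) m -> has_length (sg s * cdist C D) m.+1 ->
  cdist C' D = sg s * cdist C D.
Proof.
move=> /cdist_sg/adj_sym CC' /has_lengthE + /has_lengthE.
rewrite /cdist -{1 2}(sgV s) -invgM !lenV => -> ls.
rewrite (retr_asc CC') //; apply/negP => /len_dsc.
have contra k l : l = k.+1 -> l.+1 = k -> False by lia.
by move/contra => /(_ ls).
Qed.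

Lemma cdist_ex s C D : exists C', cdist C' C = sg s /\
  cdist C' D = sg s * cdist C D.
Proof.
suff [C' C'C rC'] : exists2 C', adj s C' C & retr D C' = retr D C * sg s.
  exists C'; split; first exact/cdist_sg.
  by rewrite /cdist rC' invgM sgV.
have [Cs|Cs] := boolP (dsc (retr D C) s); first exact: retr_dsc.
have [k kC] : exists k : J, k != C.2.
  have [->|h] := eqVneq C.2 ord0; last by exists ord0; rewrite eq_sym.
  by exists ord_max; rewrite -val_eqE /=; lia.
have CC' : adj s C (cham_of s (panel s C) k).
  by split; rewrite ?panel_of // => e; rewrite e eqxx in kC.
exists (cham_of s (panel s C) k); first exact: adj_sym.
exact: retr_asc CC' Cs.
Qed.

Definition gbuilding : building A2tilde :=
  Building cdist_inhabited cdist_eq1 cdist_adj cdist_adj_reduced cdist_ex.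

Lemma gbuilding_thick : thick gbuilding.
Proof.
move=> s C; have [j [k [jC kC jk]]] : exists j k : J, [/\ j != C.2, k != C.2 & j != k].
  have z1 : (1 < q.+1)%N by lia.
  have z2 : (2 < q.+1)%N by lia.
  have [C0|C0] := eqVneq C.2 ord0.
    by exists (Ordinal z1), (Ordinal z2); rewrite C0.
  have [C1|C1] := eqVneq C.2 (Ordinal z1).
    by exists ord0, (Ordinal z2); rewrite C1.
  by exists ord0, (Ordinal z1); rewrite !(eq_sym _ C.2).
have ad l : l != C.2 -> adj s C (cham_of s (panel s C) l).
  by move=> lC; split; rewrite ?panel_of // => e; rewrite e eqxx in lC.
exists (cham_of s (panel s C) j), (cham_of s (panel s C) k); split.
- exact/cdist_sg/ad.
- exact/cdist_sg/ad.
- by move=> /(congr1 snd) /= e; rewrite e eqxx in jk.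
Qed.

Lemma gbuilding_locally_finite : locally_finite gbuilding.
Proof.
move=> s C; apply: (@sub_finite_set _ _ (range (cham_of s (panel s C)))).
  move=> D /cdist_sg[CD _]; exists D.2 => //.
  by rewrite CD; exact: cham_of_panel.
exact/finite_image/finite_finset.
Qed.

Lemma translate_cdist g C D : cdist (translate g C) (translate g D) = cdist C D.
Proof. by rewrite /cdist retr_translate. Qed.

End Lattice.

(** * The lattice *)

Lemma ultra_finite (T : Type) (Y : choiceType) (F : set_system T) (h : T -> Y)
    (S : set Y) :
  UltraFilter F -> finite_set S -> F (h @^-1` S) -> exists y, F [set x | h x = y].
Proof.
move=> UF /finite_seqP[s ->]; elim: s => [|y s IHs] Fs.
  by have [x] := filter_ex Fs; rewrite /= in_nil.
have [?|Fy] := in_ultra_setVsetC [set x | h x = y] UF; first by exists y.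
apply: IHs; apply: filterS (filterI Fs Fy) => x /= [].
by rewrite inE => /orP[/eqP|].
Qed.

Section UniformLattice.
Variables (q : nat) (delta : 'I_3 -> 'I_q.+1 -> 'Z_(singer_order q)).
Hypothesis q_gt1 : (1 < q)%N.
Hypothesis delta_diff : forall a, perfect_difference (delta a).
Hypothesis delta0 : forall a, delta a ord0 = 0%R.

Local Notation J := 'I_q.+1.
Local Notation G := (Gamma2 delta).
Local Notation X := (gbuilding q_gt1 delta_diff delta0).

Lemma translate_automorphism (g : G) : is_automorphism (translate g : X -> X).
Proof.
split; first by exists (translate g^-1) => D; rewrite translateM ?mulVg ?mulgV translate1.
exists 1 => s C D; rewrite perm1 /s_adjacent.
have -> // : wdist (translate g C : X) (translate g D) = wdist C D.
exact: translate_cdist.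
Qed.

Definition translate_aut (g : G) : aut X := mk_aut (translate_automorphism g).

Lemma translate_autM : {morph translate_aut : x y / x * y}.
Proof.
by move=> x y; apply/val_inj/funext => D /=; rewrite translateM.
Qed.

Lemma translate_aut1 : translate_aut 1 = 1.
Proof. by apply/val_inj/funext => D /=; rewrite translate1. Qed.

HB.instance Definition _ := isMultiplicative.Build G (aut X) translate_aut translate_autM.
HB.instance Definition _ :=
  Multiplicative_isUMagmaMorphism.Build G (aut X) translate_aut translate_aut1.

Definition translate_morphism : UMagmaMorphism.type G (aut X) := translate_aut.

Lemma translate_aut_inj (j : J) (g h : G) :
  val (translate_morphism g) (1, j) = val (translate_morphism h) (1, j) -> g = h.
Proof. by move=> /(congr1 fst) /=; rewrite !mulg1. Qed.

(** Once the image of a chamber is constant along the ultrafilter, the image of a neighbour ranges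
    over finitely many chambers. The map [h] allows both [f] and its inverse. *)
Lemma aut_limit_point (F : set_system (aut X)) (h : aut X -> aut X) (j0 : J) (d : X) :
  UltraFilter F -> F [set f | val (h f) (1, j0) = d] ->
  forall C, exists D, F [set f | val (h f) C = D].
Proof.
move=> UF Fd; apply: (@panel_closed _ _ q_gt1 delta_diff delta0 j0); last by exists d.
move=> s C C' CC' [D FD]; have [<-|nCC'] := pselect (C = C'); first by exists D.
pose S := [set E : X | exists t, adj t (D : cham delta) E].
have fS : finite_set S.
  have -> : S = \bigcup_(t in [set: 'I_3]) [set E : X | s_adjacent t D E].
    apply/seteqP; split=> E.
      by move=> [t a]; exists t => //; exact/(cdist_sg q_gt1 delta_diff delta0).
    by move=> [t _ /(cdist_sg q_gt1 delta_diff delta0) a]; exists t.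
  apply: bigcup_finite => [|t _]; first exact: finite_finset.
  exact: gbuilding_locally_finite.
apply: (ultra_finite UF fS); apply: filterS FD => f /= fC.
have [_ [tau ftau]] := autP (h f); exists (tau s); rewrite -fC.
apply/(cdist_sg q_gt1 delta_diff delta0)/(ftau s C C').
by apply/(cdist_sg q_gt1 delta_diff delta0).
Qed.

(** An ultrafilter converges on every chamber, for the automorphisms and for their inverses, and
    their type permutations are constant along it; hence the pointwise limit is again an
    automorphism. *)
Lemma aut_transporter_compact (j0 : J) :
  compact [set f : aut X | val f (1, j0) = (1, ord0)].
Proof.
rewrite compact_ultra => F UF Fd.
have lim := @aut_limit_point F id j0 (1, ord0) UF Fd.
have lim' C : exists D, F [set f : aut X | val f^-1 C = D].
  move: C; apply: (@aut_limit_point F (fun f => f^-1) ord0 (1, j0)).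
  by apply: filterS Fd => f /= <-; exact: (aut_invK f).
have [tau Ftau] : exists tau : {perm 'I_3}, F [set f : aut X |
    forall s C D, s_adjacent s C D <-> s_adjacent (tau s) (val f C) (val f D)].
  pose t (f : aut X) := projT1 (cid (autP f).2).
  have [tau Ftau] : exists tau, F [set f | t f = tau].
    by apply: (ultra_finite (S := setT)); [exact: finite_finset|exact: filterT].
  by exists tau; apply: filterS Ftau => f /= <-; rewrite /t; case: cid.
pose g C := projT1 (cid (lim C)); pose g' C := projT1 (cid (lim' C)).
have Fg C : F [set f | val f C = g C] by rewrite /g; case: cid.
have Fg' C : F [set f : aut X | val f^-1 C = g' C] by rewrite /g'; case: cid.
have gK : cancel g g'.
  move=> C; have [f [/= <- <-]] := filter_ex (filterI (Fg C) (Fg' (g C))).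
  exact: (aut_invK f).
have g'K : cancel g' g.
  move=> C; have [f [/= <- <-]] := filter_ex (filterI (Fg (g' C)) (Fg' C)).
  exact: (aut_invKV f).
have ag : is_automorphism g.
  split; first by exists g'.
  exists tau => s C D.
  have [f [[/= <- <-]]] := filter_ex (filterI (filterI (Fg C) (Fg D)) Ftau).
  exact.
exists (mk_aut ag); split.
  by have [f [/= <- <-]] := filter_ex (filterI (Fg (1, j0)) Fd).
exact: cvg_aut.
Qed.

Lemma gbuilding_uniform_lattice : is_uniform_lattice G (aut X).
Proof.
exists translate_morphism; split.
- by move=> g h gh; apply: (@translate_aut_inj ord0); rewrite gh.
(* Discreteness: the image of one chamber determines a translation. *)
- move=> _ [g _ <-]; split; first by apply/mem_set; exists g.
  exists [set f | val f (1, ord0) = val (translate_morphism g) (1, ord0)];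
    first exact: near_aut.
  apply/seteqP; split=> [f /= [fE [h _ hf]]|f /= ->]; last by split=> //; exists g.
  by move: fE; rewrite -hf => /translate_aut_inj ->.
(* If f sends (g, j) to (1, 0), then f composed with translation by g sends (1, j) to (1, 0); so
   these finitely many compact sets meet every coset. *)
pose K := \big[setU/set0]_(j <- enum J) [set f : aut X | val f (1, j) = (1, ord0)].
have cK : compact K.
  by apply: bigsetU_compact => j _; exact: aut_transporter_compact.
have -> : [set: coset_space translate_morphism] =
    (\pi_(coset_space translate_morphism) : aut X -> _) @` K.
  apply/esym/seteqP; split=> // x _.
  rewrite -[x]reprK; set f := repr x.
  pose D := val f^-1 (1, ord0); exists (f * translate_morphism D.1).
    rewrite /K -bigcup_seq; exists D.2; first by rewrite /= mem_enum.
    rewrite /= /translate /= mulg1; have := aut_invKV f (1, ord0).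
    by rewrite -/D; case: D.
  apply/eqmodP; rewrite /= /lcoset_rel; apply/asboolP; exists (D.1)^-1.
  by rewrite gmulfV mulgK.
apply: continuous_compact cK; apply: continuous_subspaceT.
exact: pi_continuous.
Qed.

End UniformLattice.

(** * Classical difference sets *)

Lemma line_uniq (F : finFieldType) (u v : Defs.point F) (l l' : line F) : u <> v ->
  incident u l -> incident v l -> incident u l' -> incident v l' -> l = l'.
Proof.
rewrite /incident => uv ul vl ul' vl'; have du := eqP (valP u); have dv := eqP (valP v).
have cap0 : \dim (val u :&: val v) = 0%N.
  have := dimvS (capvSl (val u) (val v)); rewrite du leq_eqVlt ltnS leqn0.
  case/orP=> [/eqP d1|/eqP//]; exfalso; apply/uv/val_inj.
  have /eqP <- : (val u :&: val v == val u)%VS by rewrite eqEdim capvSl du d1.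
  by apply/eqP; rewrite eqEdim capvSr dv d1.
have d2 : \dim (val u + val v) = 2%N.
  by have := dimv_sum_cap (val u) (val v); rewrite cap0 addn0 du dv.
have sub (m : line F) : (val u <= val m)%VS -> (val v <= val m)%VS ->
    (val u + val v)%VS = val m.
  by move=> um vm; apply/eqP; rewrite eqEdim subv_add um vm d2 (eqP (valP m)).
by apply: val_inj; rewrite /= -(sub l) // -(sub l').
Qed.

Section ClassicalDifferenceSet.
Variables (q : nat) (q_gt1 : (1 < q)%N).
Local Notation n := (singer_order q).

(* The order of a translation stabilizing a set of [q + 1] residues divides
   both [q + 1] and [q ^ 2 + q + 1], which are coprime. *)
Lemma stable_shift_eq0 (A : {set 'Z_n}) (a : 'Z_n) : #|A| = q.+1 ->
  (forall x, ((x + a)%R \in A) = (x \in A)) -> a = 0%R.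
Proof.
move=> cA Aa.
have e : (\sum_(x in A) x = \sum_(x in A) x + a *+ q.+1 :> 'Z_n)%R.
  rewrite -cA -sumr_const -big_split /=.
  rewrite (reindex_inj (addIr a)) /=.
  by apply: eq_bigl => x; rewrite Aa.
have aq : (a *+ q.+1 = 0)%R.
  by apply: (@addrI _ (\sum_(x in A) x)%R); rewrite -e addr0.
have n0 : ((n%:R : 'Z_n) = 0)%R by rewrite pchar_Zp // singer_order_gt1.
have nE : n = (q.+1 * q + 1)%N by rewrite /singer_order; lia.
have : (a *+ n = 0)%R by rewrite -mulr_natr n0 mulr0.
have -> : (a *+ n = a *+ (q.+1 * q + 1))%R by congr (_ *+ _)%R.
by rewrite mulrnDr mulrnA aq mul0rn add0r.
Qed.

(** There are as many ordered pairs of distinct labels as nonzero residues, namely q^2 + q, so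
    uniqueness of differences gives existence. *)
Lemma perfect_difference_card (d : 'I_q.+1 -> 'Z_n) : injective d ->
  (forall j k j' k', d j - d k = d j' - d k' -> j != k -> j = j' /\ k = k')%R ->
  perfect_difference d.
Proof.
move=> d_inj d_uniq; split=> // a.
have [->|a0] := eqVneq a 0%R; first by exists (ord0, ord0); rewrite subrr.
pose S := [set jk : 'I_q.+1 * 'I_q.+1 | jk.1 != jk.2]%SET.
pose f (jk : 'I_q.+1 * 'I_q.+1) := (d jk.1 - d jk.2)%R.
have cS : #|S| = (q ^ 2 + q)%N.
  have -> : S = (~: [set (j, j) | j in [set: 'I_q.+1]])%SET.
    apply/setP => -[j k]; rewrite !inE /=; congr (~~ _).
    apply/eqP/imsetP => [<-|[i _ [-> ->]]] //.
    by exists j; rewrite ?inE.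
  rewrite cardsCs finset.setCK card_imset; last by move=> j k [].
  by rewrite cardsT card_prod card_ord; lia.
have fS : (f @: S = [set~ 0%R])%SET.
  apply/eqP; rewrite eqEcard; apply/andP; split.
    apply/fintype.subsetP => x /imsetP[[j k]]; rewrite !inE /= => jk ->.
    by apply: contra jk; rewrite /f subr_eq0 => /eqP/d_inj/eqP.
  rewrite card_in_imset ?cS; last first.
    move=> [j k] [j' k']; rewrite !inE /= => jk _ e.
    by have [-> ->] := d_uniq j k j' k' e jk.
  rewrite cardsC1 card_ord Zp_cast ?singer_order_gt1 //.
  by rewrite /singer_order addn1.
have : a \in (f @: S)%SET by rewrite fS !inE.
by case/imsetP => jk _ ->; exists jk.
Qed.

Lemma classical_perfect_difference (D : set 'Z_n) (d : 'I_q.+1 -> 'Z_n) :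
  classical_difference_set D -> set_bij [set: 'I_q.+1] D d -> perfect_difference d.
Proof.
move=> [F [_ [s [p [l [[s_triv _ s_free] DE]]]]]] dD.
have n_gt0 : (0 < n)%N by exact: ltnW (singer_order_gt1 q_gt1).
have d_inj : injective d.
  by move=> j k jk; apply: (set_bij_inj dD) => //; rewrite inE.
have [ptn lnn] : power_trivial s n by apply/s_triv.
(* Exponents in ['Z_n] act through representatives, so iterates have to be reduced modulo n. *)
have pt_mod k x : iter (k %% n) (on_points s) x = iter k (on_points s) x.
  rewrite {2}(divn_eq k n) addnC iterD; congr iter.
  by elim: (k %/ n)%N => //= m IHm; rewrite mulSn iterD -IHm ptn.
have ln_mod k x : iter (k %% n) (on_lines s) x = iter k (on_lines s) x.
  rewrite {2}(divn_eq k n) addnC iterD; congr iter.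
  by elim: (k %/ n)%N => //= m IHm; rewrite mulSn iterD -IHm lnn.
pose pt (a : 'Z_n) := iter a (on_points s) p.
pose ln (a : 'Z_n) := iter a (on_lines s) l.
have valD (a c : 'Z_n) : (a + c)%R = (c + a) %% n :> nat.
  by rewrite addrC /=; congr (_ %% _)%N; exact: (Zp_cast (singer_order_gt1 q_gt1)).
have ptD a c : pt (a + c)%R = iter c (on_points s) (pt a).
  by rewrite /pt valD pt_mod iterD.
have lnD a c : ln (a + c)%R = iter c (on_lines s) (ln a).
  by rewrite /ln valD ln_mod iterD.
have incD a b c : incident (pt (a + c)%R) (ln (b + c)%R) = incident (pt a) (ln b).
  rewrite ptD lnD; elim: (c : nat) => //= m IHm.
  by rewrite on_incident IHm.
have pt_inj a b : pt a = pt b -> a = b.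
  move=> ab; have h : pt 0%R = pt (b - a)%R by rewrite ptD -ab -ptD subrr.
  have /s_free/s_triv : iter (b - a)%R (on_points s) p = p by rewrite -/(pt _) -h.
  rewrite /dvdn modn_small => [/eqP ba|]; last first.
    by rewrite -[X in (_ < X)%N](Zp_cast (singer_order_gt1 q_gt1)) ltn_ord.
  by apply/esym/eqP; rewrite -subr_eq0; apply/eqP/val_inj.
have inD x : D x = incident (pt 0%R) (ln x) by rewrite DE.
pose A := [set x | incident (pt 0%R) (ln x)]%SET.
have cA : #|A| = q.+1.
  have -> : A = [set d j | j in [set: 'I_q.+1]]%SET.
    apply/setP => x; rewrite inE; apply/idP/imsetP => [|[j _ ->]]; rewrite -inD.
      by move=> /(set_bij_surj dD)[j _ <-]; exists j; rewrite ?inE.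
    by have /set_bij_homo := dD; apply.
  by rewrite card_imset // cardsT card_ord.
apply: perfect_difference_card => // j k j' k' e jk.
have [kk|kk] := eqVneq k k'.
  by split=> //; apply: d_inj; move: e; rewrite kk => /addIr.
exfalso; pose a := (d j - d k)%R.
have dP i : incident (pt 0%R) (ln (d i)).
  by rewrite -inD; have /set_bij_homo := dD; apply.
(* The distinct points with indices - d k and - d k' lie on both lines. Equality of the lines makes
   [A] stable under translation by [a], whence a = 0. *)
have l0 : ln 0%R = ln a.
  apply: (@line_uniq _ (pt (0 - d k)%R) (pt (0 - d k')%R)).
  - by move=> /pt_inj; rewrite !sub0r => /oppr_inj/d_inj/eqP; rewrite (negbTE kk).
  - by rewrite -(subrr (d k)) incD subrr.
  - by rewrite -(subrr (d k')) incD subrr.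
  - by rewrite incD.
  - by rewrite /a e incD.
have : a = 0%R.
  apply: (stable_shift_eq0 cA) => x.
  by rewrite !inE addrC lnD -l0 -lnD add0r.
by move/subr0_eq/d_inj/eqP; rewrite (negbTE jk).
Qed.

End ClassicalDifferenceSet.

Theorem theorem0p2 (q p k : nat) (p_prime : prime p) (k_gt0 : (0 < k)%N)
    (q_eq : q = (p ^ k)%N)
    (Delta : 'I_3 -> set 'Z_(singer_order q))
    (Delta_classical : forall a, classical_difference_set (Delta a))
    (Delta0 : forall a, Delta a 0%R)
    (delta : 'I_3 -> 'I_q.+1 -> 'Z_(singer_order q))
    (delta_bij : forall a, set_bij [set: 'I_q.+1] (Delta a) (delta a))
    (delta0 : forall a, delta a ord0 = 0%R) :
  exists X : building A2tilde,
    [/\ thick X, locally_finite X & is_uniform_lattice (Gamma2 delta) (aut X)].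
Proof.
have q_gt1 : (1 < q)%N.
  by rewrite q_eq (leq_trans (prime_gt1 p_prime)) // -[X in (X <= _)%N]expn1
     leq_exp2l // prime_gt1.
have delta_diff a : perfect_difference (delta a).
  exact: classical_perfect_difference (Delta_classical a) (delta_bij a).
exists (gbuilding q_gt1 delta_diff delta0); split.
- exact: gbuilding_thick.
- exact: gbuilding_locally_finite.
- exact: gbuilding_uniform_lattice.
Qed.
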